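(* Let $\mathbf{a}$ be a weak composition of length $n$. There is an injective map $\Phi:\mathrm{LKT}(\mathbf{a})\to\mathrm{KKT}(\mathbf{a})$ such that $\mathrm{wt}(\Phi(T))=\mathrm{wt}(T)$ for all $T$, and for every $T\in\mathrm{LKT}(\mathbf{a})$ and $1\le i<n$: if $e_i(T)\neq0$ then $\Phi(e_i(T))=e_i(\Phi(T))$, and if $f_i(T)\neq0$ then $\Phi(f_i(T))=f_i(\Phi(T))$. (Here $e_i,f_i$ on the left are the lock raising/lowering operators and on the right the key raising/lowering operators.)
   Context: A weak composition is a finite sequence $\mathbf{a}=(a_1,\ldots,a_n)$ of nonnegative integers. A diagram is a finite set of cells $(c,r)$ with $c,r$ positive integers ($c$ column, $r$ row, rows numbered from the bottom). A labeled diagram assigns a positive integer label to each cell; $\mathbb{D}(T)$ is its underlying diagram, and its weight $\mathrm{wt}(T)$ is the weak composition whose $r$-th part is the number of cells in row $r$. A key Kohnert tableau of content $\mathbf{a}$: labels $1^{a_1},\ldots,n^{a_n}$, one per cell, with (K1) exactly one $i$ in each of columns $1,\ldots,a_i$; (K2) every label in row $r$ is at least $r$; (K3) cells labeled $i$ weakly descend from left to right; (K4) if $i<j$ appear in a column with $i$ above $j$, there is an $i$ in the column immediately to the right strictly above the row of that $j$. A lock Kohnert tableau of content $\mathbf{a}$ (with $M=\max_i a_i$): labels $1^{a_1},\ldots,n^{a_n}$, one per cell, with (L1) exactly one $i$ in each of columns $M-a_i+1,\ldots,M$; (L2)=(K2); (L3)=(K3); (L4) labels strictly decrease going down each column. $\mathrm{KKT}(\mathbf{a})$,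 $\mathrm{LKT}(\mathbf{a})$ denote these sets; in each set, a diagram has at most one valid labeling. Raising operators on diagrams: the vertical $i$-pairing of $D$ pairs cells of rows $i,i+1$ in the same column, then iteratively pairs any unpaired cell of row $i+1$ with the rightmost unpaired cell of row $i$ in a column to its left whenever all cells of rows $i,i+1$ in the columns strictly between them are paired; $e_i(D)$ moves the rightmost unpaired cell of row $i+1$ to row $i$ (same column), and $e_i(D)=0$ if there is none. Key raising operator: for $T\in\mathrm{KKT}(\mathbf{a})$, $e_i(T)$ is the unique element of $\mathrm{KKT}(\mathbf{a})$ with underlying diagram $e_i(\mathbb{D}(T))$ if $e_i(\mathbb{D}(T))\ne0$ (such an element always exists), else $0$. Lock raising operator: for $T\in\mathrm{LKT}(\mathbf{a})$, $e_i(T)$ is the unique element of $\mathrm{LKT}(\mathbf{a})$ with underlying diagram $e_i(\mathbb{D}(T))$ if $e_i(\mathbb{D}(T))\neq0$ and such an element exists, else $0$. In either set $X$, the lowering operator is $f_i(T)=T'$ if $T'\in X$ satisfies $e_i(T')=T$, and $f_i(T)=0$ if no such $T'$ exists. *)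

(* Defs.v *)
From mathcomp Require Import all_boot finmap.
From mathcomp Require Import boolp classical_sets functions.

Set Implicit Arguments.
Unset Strict Implicit.
Unset Printing Implicit Defensive.

Local Open Scope fset_scope.
Local Open Scope fmap_scope.

(* Columns and rows are numbered from 1, rows from bottom to top. *)
Notation cell := (nat * nat)%type.

Definition col (x : cell) : nat := x.1.
Definition row (x : cell) : nat := x.2.

Notation diagram := {fset cell}.

(* A finite map assigns exactly one label to each cell of its domain; the
   positivity of the coordinates and of the labels is part of [content]. *)
Notation ltableau := {fmap cell -> nat}.

Definition shape (T : ltableau) : diagram := domf T.

(* [wt T r] is the [r]-th part of the weight, for [r >= 1]. *)
Definition wt (T : ltableau) (r : nat) : nat :=
  #|` [fset x in shape T | row x == r] |.

(** * Key and lock Kohnert tableaux *)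

(* The cells are in positive rows and columns, and the labels are
   1^{a_1}, ..., n^{a_n}.  Labels start at 1 and ['I_n] at 0, so that [i : 'I_n]
   stands for the label [i.+1], whose multiplicity is [tnth a i]. *)
Definition content (n : nat) (a : n.-tuple nat) (T : ltableau) : Prop :=
  [/\ forall x, x \in shape T -> (0 < col x) && (0 < row x),
      forall x l, T.[? x] = Some l -> 0 < l <= n
    & forall i : 'I_n,
        #|` [fset x in shape T | T.[? x] == Some i.+1] | = tnth a i].

Definition once_in_column (T : ltableau) (l c : nat) : Prop :=
  exists! r, T.[? (c, r)] = Some l.

Definition labels_ge_row (T : ltableau) : Prop :=
  forall c r l, T.[? (c, r)] = Some l -> r <= l.

Definition labels_weakly_descend (T : ltableau) : Prop :=
  forall l c c' r r', c < c' ->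
    T.[? (c, r)] = Some l -> T.[? (c', r')] = Some l -> r' <= r.

Definition key_inversions (T : ltableau) : Prop :=
  forall i j c r s, i < j -> s < r ->
    T.[? (c, r)] = Some i -> T.[? (c, s)] = Some j ->
    exists2 t, s < t & T.[? (c.+1, t)] = Some i.

Definition columns_strict (T : ltableau) : Prop :=
  forall i j c r s, s < r ->
    T.[? (c, r)] = Some i -> T.[? (c, s)] = Some j -> j < i.

Definition KKT (n : nat) (a : n.-tuple nat) : set ltableau :=
  fun T =>
    [/\ content a T,
        forall (i : 'I_n) c, 1 <= c <= tnth a i -> once_in_column T i.+1 c,
        labels_ge_row T,
        labels_weakly_descend T
      & key_inversions T].

Definition max_part (n : nat) (a : n.-tuple nat) : nat :=
  \max_(i < n) tnth a i.

Definition LKT (n : nat) (a : n.-tuple nat) : set ltableau :=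
  fun T =>
    [/\ content a T,
        forall (i : 'I_n) c, max_part a - tnth a i + 1 <= c <= max_part a ->
          once_in_column T i.+1 c,
        labels_ge_row T,
        labels_weakly_descend T
      & columns_strict T].

(** * Vertical pairing and raising operators on diagrams *)

(* Below, [P] is the set of the cells that are already paired. *)

Definition column_paired (i : nat) (D : diagram) : {fset cell} :=
  [fset x in D | ((row x == i) && ((col x, i.+1) \in D))
              || ((row x == i.+1) && ((col x, i) \in D))].

(* The last condition makes [y] the rightmost unpaired cell of row [i] to the
   left of [x]. *)
Definition pairable (i : nat) (D : diagram) (P : {fset cell}) (x y : cell) :
    bool :=
  [&& x \in D, row x == i.+1, x \notin P,
      y \in D, row y == i, y \notin P,
      col y < col x
    & [fset z in D | ((row z == i) || (row z == i.+1))
                  && (col y < col z < col x)] `<=` P].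

(* At any stage distinct pairable pairs are disjoint, and pairing one of them
   leaves the others pairable: the order of the choices is immaterial. *)
Definition pair_step (i : nat) (D : diagram) (P : {fset cell}) : {fset cell} :=
  if [pick xy : D * D | pairable i D P (val xy.1) (val xy.2)] is Some xy
  then val xy.1 |` (val xy.2 |` P) else P.

(* Each effective step pairs two new cells, so [#|` D |] steps suffice. *)
Definition vpaired (i : nat) (D : diagram) : {fset cell} :=
  iter #|` D | (pair_step i D) (column_paired i D).

Definition upper_unpaired (i : nat) (D : diagram) : {fset cell} :=
  [fset x in D | (row x == i.+1) && (x \notin vpaired i D)].

(* [None] stands for the value 0 of the operators. *)
Definition raise_diagram (i : nat) (D : diagram) : option diagram :=
  let U := upper_unpaired i D in
  if [pick x : U | [forall y : U, col (val y) <= col (val x)]] is Some x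
  then Some ((col (val x), i) |` (D `\ val x)) else None.

(** * Raising and lowering operators on a set [X] of labeled diagrams *)

Definition choose_in (T : Type) (A : set T) : option T :=
  if pselect (exists x, A x) is left exA then Some (projT1 (cid exA)) else None.

(* For [X] equal to [KKT a] or [LKT a] there is at most one suitable [T'] in
   both definitions. *)
Definition raise (X : set ltableau) (i : nat) (T : ltableau) :
    option ltableau :=
  choose_in (fun T' => X T' /\ raise_diagram i (shape T) = Some (shape T')).

Definition lower (X : set ltableau) (i : nat) (T : ltableau) :
    option ltableau :=
  choose_in (fun T' => X T' /\ raise X i T' = Some T).

(* Main.v *)
Require Import Defs.
From mathcomp Require Import all_boot finmap.
From mathcomp Require Import fingroup perm zify.
From mathcomp Require Import boolp classical_sets functions.

(** View a diagram as a 0-1 matrix.  Besides the vertical raising operators it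
    carries horizontal ones, acting on two adjacent columns, and the two
    families commute.  The number of cells in each column of a lock tableau is
    the reverse of that of a key tableau of the same content, so the lock
    diagrams are horizontally of lowest weight and the key diagrams of highest
    weight: Phi is the action of the longest permutation of the columns, a
    product of adjacent reflections.  On the diagrams met on the way such a
    reflection moves to the left every cell of the right-hand column that is
    unpaired horizontally; this keeps the rows, is injective, and commutes with
    the vertical operators by a computation on two rows and two columns.

    That the result is a key diagram is seen on labelings subject only to the
    conditions on content, K2 and K3.  Exchanging two labels in a range of
    columns preserves these conditions, and exchanges that increase a weighted
    sum of rows lead, before a reflection, to a labeling in which the unpaired
    cells are exactly those whose label has to move, and, at the end, to a
    labeling satisfying K4. *)

Set Implicit Arguments.
Unset Strict Implicit.
Unset Printing Implicit Defensive.

Local Open Scope fset_scope.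
Local Open Scope fmap_scope.
Local Open Scope nat_scope.

Implicit Types (D P : diagram) (T : ltableau) (b c d r : nat) (z : cell).

(** * The raising operator on diagrams *)

Section Diagrams.

Implicit Types (i j k : nat).

Definition before (D : diagram) (r b : nat) : nat :=
  \sum_(d < b) ((d : nat, r) \in D).

Lemma before0 D r : before D r 0 = 0.
Proof. by rewrite /before big_ord0. Qed.

Lemma beforeS D r b : before D r b.+1 = before D r b + ((b, r) \in D).
Proof. by rewrite /before big_ord_recr. Qed.

(* The height at [x] is the number of cells of row [i] minus the number of cells
   of row [i.+1] in the columns [< x]: an unpaired upper cell is a strict record
   minimum of the height, and [raises_at] is its first global minimum. *)
Definition unmatched (i : nat) (D : diagram) (x : nat) : Prop :=
  forall d, d <= x ->
    before D i x.+1 + before D i.+1 d < before D i d + before D i.+1 x.+1.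

Definition raises_at (i : nat) (D : diagram) (b : nat) : Prop :=
  unmatched i D b /\ forall d, b < d ->
    before D i b.+1 + before D i.+1 d <= before D i d + before D i.+1 b.+1.

Definition lower_cell (i : nat) (D : diagram) (b : nat) : diagram :=
  (b, i) |` (D `\ (b, i.+1)).

(* The two inequalities say that no pair straddles an unpaired cell. *)
Definition pairing_inv (i : nat) (D P : diagram) : Prop :=
  [/\ P `<=` D, column_paired i D `<=` P,
      forall z, z \in D -> z \notin P -> (row z == i) || (row z == i.+1) ->
        forall d, d <= col z ->
        before P i (col z).+1 + before P i.+1 d <=
        before P i d + before P i.+1 (col z).+1,
      forall z, z \in D -> z \notin P -> (row z == i) || (row z == i.+1) ->
        forall d, col z <= d ->
        before P i.+1 d.+1 + before P i (col z) <=
        before P i.+1 (col z) + before P i d.+1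
    & forall x, (x, i.+1) \in P -> ~ unmatched i D x].

Lemma before_cons z P r b : z \notin P ->
  before (z |` P) r b = before P r b + ((row z == r) && (col z < b)).
Proof.
move=> zP; elim: b => [|b IH]; first by rewrite !before0 ltn0 andbF.
rewrite !beforeS IH in_fset1U.
case: (altP ((b, r) =P z)) => [e|bz] /=.
  by move: zP; rewrite -e /row /col /= eqxx ltnn ltnS leqnn => /negbTE->; lia.
have : ~~ ((row z == r) && (col z == b)).
  by apply: contra bz => /andP[/eqP <- /eqP <-]; case: (z).
lia.
Qed.

Lemma column_pairedP i D c : 
  ((c, i) \in column_paired i D) = ((c, i) \in D) && ((c, i.+1) \in D).
Proof. by rewrite !inE /row /col /= eqxx (ltn_eqF (ltnSn i)) orbF. Qed.

Lemma column_pairedSP i D c : 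
  ((c, i.+1) \in column_paired i D) = ((c, i) \in D) && ((c, i.+1) \in D).
Proof. by rewrite !inE /row /col /= eqxx (gtn_eqF (ltnSn i)) /= andbC. Qed.

Lemma pairing_inv_column i D : pairing_inv i D (column_paired i D).
Proof.
have eqb b : before (column_paired i D) i b = before (column_paired i D) i.+1 b.
  by elim: b => [|b IH]; rewrite ?before0 // !beforeS IH column_pairedP column_pairedSP.
split=> //; try by move=> *; rewrite !eqb; lia.
- by apply/fsubsetP => x; rewrite !inE => /andP[].
- move=> x; rewrite column_pairedSP => /andP[h1 h2] /(_ x (leqnn x)).
  rewrite !beforeS h1 h2; lia.
Qed.

Lemma before_sub i D P b d : b <= d ->
  (forall k, b <= k < d -> ((k, i) \in D) = ((k, i) \in P)) ->
  before D i d + before P i b = before D i b + before P i d.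
Proof.
elim: d => [|d IH] bd H; first by move: bd; rewrite leqn0 => /eqP ->; lia.
move: bd; rewrite leq_eqVlt => /orP[/eqP ->|]; first lia.
rewrite ltnS => bd; rewrite !beforeS.
have -> : ((d, i) \in D) = ((d, i) \in P) by apply: H; lia.
have := IH bd (fun k kb => H k ltac:(lia)).
lia.
Qed.

(** No other unpaired cell of the two rows lies weakly between the columns of [y] and [x]. Hence an
    interval ending at an unpaired cell contains [x] whenever it contains [y], and one starting
    there contains [y] whenever it contains [x]. Strictly between the two, [D] and [P] agree, so the
    inequality starting at [y] shows that [x] is no record minimum. *)
Lemma pairing_inv_step i D P x y : pairing_inv i D P -> pairable i D P x y ->
  pairing_inv i D (x |` (y |` P)).
Proof.
move=> [PD cP I1 I2 I3] /and5P[xD /eqP rx xP yD /and4P[/eqP ry yP ltyx /fsubsetP btw]].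
have bE r b : before (x |` (y |` P)) r b =
   before P r b + ((row y == r) && (col y < b)) + ((row x == r) && (col x < b)).
  rewrite before_cons ?before_cons // in_fset1U negb_or xP andbT.
  by apply/eqP => e; move: rx; rewrite e ry; lia.
have out z : z \in D -> z \notin x |` (y |` P) ->
    (row z == i) || (row z == i.+1) -> (col z < col y) || (col x < col z).
  move=> zD; rewrite !inE !negb_or => /and3P[zx zy zP] rz.
  have nb : ~~ (col y < col z < col x).
    by apply: contra zP => h; apply: btw; rewrite !inE zD rz.
  have [e|ne] := eqVneq (col z) (col x).
    suff /(fsubsetP cP) : z \in column_paired i D by rewrite (negbTE zP).
    case: z zD zx {zy zP nb} rz e => cz s; case: x xD rx {xP ltyx btw bE} => cx r.
    rewrite /row /col /= => xD er zD zx rz e; subst cz r.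
    case/orP: rz => /eqP e; subst s; first by rewrite column_pairedP zD xD.
    by rewrite eqxx in zx.
  have [e|ne'] := eqVneq (col z) (col y).
    suff /(fsubsetP cP) : z \in column_paired i D by rewrite (negbTE zP).
    case: z zD zy {zx zP nb ne} rz e => cz s; case: y yD ry {yP ltyx btw bE} => cx r.
    rewrite /row /col /= => yD er zD zx rz e; subst cz r.
    case/orP: rz => /eqP e; subst s; last by rewrite column_pairedSP zD yD.
    by rewrite eqxx in zx.
  by move: nb ne ne' ltyx; clear; lia.
split.
- by rewrite !fsubUset !fsub1set xD yD PD.
- by apply: (fsubset_trans cP); rewrite fsetUA fsubsetUr.
- move=> z zD zP rz d dz; have := out z zD zP rz.
  move: zP; rewrite !inE !negb_or => /and3P[_ _ zP].
  move: ltyx (I1 z zD zP rz d dz); rewrite !bE ry rx !eqxx; move: dz; clear; lia.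
- move=> z zD zP rz d dz; have := out z zD zP rz.
  move: zP; rewrite !inE !negb_or => /and3P[_ _ zP].
  move: ltyx (I2 z zD zP rz d dz); rewrite !bE ry rx !eqxx; move: dz; clear; lia.
- move=> c; rewrite !inE => /or3P[/eqP e|/eqP e|]; last exact: I3.
  + have ecx : c = col x by rewrite -e.
    subst c; move=> /(_ (col y) (ltnW ltyx)).
    have Hp r : (r == i) || (r == i.+1) -> forall k, (col y).+1 <= k < col x ->
        ((k, r) \in D) = ((k, r) \in P).
      move=> rr k kb; apply/idP/idP => [kD|]; last by move/(fsubsetP PD).
      by apply: btw; rewrite !inE kD /row /col /= rr.
    have := before_sub ltyx (Hp i _); have := before_sub ltyx (Hp i.+1 _).
    rewrite !eqxx orbT => /(_ isT) B1 /(_ isT) B2.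
    have yr : (row y == i) || (row y == i.+1) by rewrite ry eqxx.
    have := I2 y yD yP yr (col x).-1 ltac:(lia).
    have -> : (col x).-1.+1 = col x by lia.
    move: B1 B2; rewrite !beforeS.
    have -> : (col y, i) \in D by rewrite -ry; case: (y) yD.
    have -> : (col y, i) \in P = false by rewrite -ry; case: (y) yP => ? ? /negbTE.
    have nyx : (col y, i.+1) \in D = false.
      apply: contraNF yP => h; apply: (fsubsetP cP).
      by case: (y) ry yD h => ? ?; rewrite /row /col /= => -> ? ?;
        rewrite column_pairedP; apply/andP.
    have nxx : (col x, i) \in D = false.
      apply: contraNF xP => h; apply: (fsubsetP cP).
      by case: (x) rx xD h => ? ?; rewrite /row /col /= => -> ? ?;
        rewrite column_pairedSP; apply/andP.
    rewrite nyx nxx.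
    have -> : (col y, i.+1) \in P = false.
      by apply: contraFF nyx; apply: (fsubsetP PD).
    by clear; lia.
  + by move: ry; rewrite -e /row /=; lia.
Qed.

Lemma pair_stepP i D P :
  (exists x y, pairable i D P x y /\ pair_step i D P = x |` (y |` P)) \/
  ((forall x y, ~~ pairable i D P x y) /\ pair_step i D P = P).
Proof.
rewrite /pair_step; case: pickP => [[x y] /= h|h].
  by left; exists (val x), (val y).
right; split => // x y; apply/negP => hp; move: (hp) => /and5P[xD _ _ yD _].
by have := h ([` xD], [` yD]); rewrite /= hp.
Qed.

Lemma pairing_inv_vpaired i D : pairing_inv i D (vpaired i D).
Proof.
rewrite /vpaired; elim: #|` D | => [|k IH] /=; first exact: pairing_inv_column.
case: (pair_stepP i D (iter k (pair_step i D) (column_paired i D))) => [[x [y [h ->]]]|[_ ->]] //.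
exact: pairing_inv_step.
Qed.

Lemma vpaired_stable i D x y : ~~ pairable i D (vpaired i D) x y.
Proof.
have : (forall x y, ~~ pairable i D (vpaired i D) x y) \/
       #|` D | <= #|` vpaired i D |.
  rewrite /vpaired; move: #|` D | => k; elim: k => [|k IH] /=; first by right.
  case: (pair_stepP i D (iter k (pair_step i D) (column_paired i D)))
    => [[u [v [h ->]]]|[hP ->]]; last by left.
  case: IH => [/(_ u v)|IH]; first by rewrite h.
  right; case/and5P: h => uD /eqP ru uP vD /and4P[/eqP rv vP _ _].
  by rewrite cardfsU1 cardfsU1 !inE negb_or uP vP andbT; case: eqP => [e|_]; lia.
case=> // le; have [PD _ _ _ _] := pairing_inv_vpaired i D.
have e : vpaired i D = D by apply/eqP; rewrite eqEfcard PD.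
by apply/negP => /and5P[xD _ xP _ _]; rewrite e xD in xP.
Qed.

(** By the invariant a paired upper cell is no record minimum. Conversely, once no pairable pair is
    left, all lower cells to the left of an unpaired upper cell are paired, and the inequality for
    [P] passes to [D]. *)
Lemma upper_unpairedP i D x :
  (x, i.+1) \in upper_unpaired i D <-> unmatched i D x.
Proof.
have [PD cP I1 I2 I3] := pairing_inv_vpaired i D.
have stab := @vpaired_stable i D.
split; last first.
  move=> U; rewrite !inE /row /= eqxx /=; apply/andP; split; last first.
    by apply/negP => /I3.
  by have := U x (leqnn x); rewrite !beforeS; case: ((x, i.+1) \in D) => //; lia.
rewrite !inE /row /= eqxx /= => /andP[xD xP].
set P := vpaired i D in PD cP I1 I2 I3 stab xP.
(* An unpaired lower cell to the left of an unpaired upper one would, at minimal distance, be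
   pairable with it. *)
have low y : y < x -> (y, i) \in D -> (y, i) \in P.
  move=> yx yD; apply/negPn/negP => yP.
  have [m] := ubnP (x - y).
  elim: m x y yx {I1 I2 I3} xD xP yD yP => // m IH x y yx xD xP yD yP le.
  move: (stab (x, i.+1) (y, i)); rewrite /pairable xD yD xP yP /row /col /= !eqxx yx /=.
  case/fsubsetPn => -[c r]; rewrite !inE /row /col /= => /andP[zD /andP[rz cz]] zP.
  case/orP: rz => /eqP e; subst r.
  - by apply: (IH x c) => //; lia.
  - by apply: (IH c y) => //; lia.
have xi : (x, i) \in D = false.
  by apply: contraNF xP => h; apply: (fsubsetP cP); rewrite column_pairedSP h.
move=> d dx; have := I1 (x, i.+1) xD xP; rewrite /row /col /= eqxx orbT.
move=> /(_ isT d dx).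
have := @before_sub i D P d x.+1 ltac:(lia).
have H k : d <= k < x.+1 -> (k, i) \in D = ((k, i) \in P).
  move=> kx; apply/idP/idP => [kD|]; last exact: (fsubsetP PD).
  apply: low => //; rewrite ltn_neqAle; apply/andP; split; last lia.
  by apply: contraFneq xi => <-.
move=> /(_ H).
suff : before P i.+1 x.+1 + before D i.+1 d < before D i.+1 x.+1 + before P i.+1 d by lia.
rewrite !beforeS xD (negbTE xP).
have {H} mono b : before P i.+1 d + before D i.+1 (d + b) >= before P i.+1 (d + b) + before D i.+1 d.
  elim: b => [|b IH]; first by rewrite addn0; lia.
  rewrite addnS !beforeS; have : (d + b, i.+1) \in P -> (d + b, i.+1) \in D by apply: (fsubsetP PD).
  by case: (_ \in P) => [->//|_]; lia.
by have := mono (x - d); rewrite subnKC //; lia.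
Qed.

Lemma raises_at_in i D b : raises_at i D b ->
  (b, i.+1) \in D /\ (b, i) \notin D.
Proof.
case=> /(_ b (leqnn b)); rewrite !beforeS.
by case: (_ \in D); case: (_ \in D) => //; lia.
Qed.

Lemma raises_at_inj i D b b' : raises_at i D b -> raises_at i D b' -> b = b'.
Proof.
move=> [u l] [u' l']; have [lt|lt|//] := ltngtP b b'.
- have := u' b.+1 lt; have := l b'.+1 ltac:(lia); lia.
- have := u b'.+1 lt; have := l' b.+1 ltac:(lia); lia.
Qed.

(** The first place after [b] where the height falls below its value just after column [b] would
    give a later record minimum. *)
Lemma rightmost_unmatched i D b : raises_at i D b <->
  unmatched i D b /\ forall d, b < d -> ~ unmatched i D d.
Proof.
split=> -[u l]; split=> // d bd.
  by move=> /(_ b.+1 bd); have := l d.+1 ltac:(lia); lia.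
elim/ltn_ind: d bd => d IH bd.
case: d => // d in IH bd *; have [e|bd'] : b = d \/ b < d by lia.
  by subst; lia.
rewrite leqNgt; apply/negP => lt; apply: (l d bd') => k kd.
have [kb|kb] := leqP k b; first by have := u k kb; lia.
by have := IH k ltac:(lia) kb; lia.
Qed.

Lemma raise_diagramP i D D' : raise_diagram i D = Some D' <->
  exists2 b, raises_at i D b & D' = lower_cell i D b.
Proof.
have U c r : (c, r) \in upper_unpaired i D -> r = i.+1.
  by rewrite !inE /row /= => /and3P[_ /eqP].
rewrite /raise_diagram; case: pickP => [[[c r] xU] /= /forallP h|h].
  have e := U _ _ xU; subst r.
  have R : raises_at i D c.
    apply/rightmost_unmatched; split; first exact/upper_unpairedP.
    move=> d cd /upper_unpairedP dU; have := h [` dU]; rewrite /col /=; lia.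
  split=> [[<-]|[b Rb ->]]; first by exists c.
  by rewrite (raises_at_inj Rb R).
split=> // -[b /rightmost_unmatched[ub lb] _].
have bU : (b, i.+1) \in upper_unpaired i D by apply/upper_unpairedP.
have := h [` bU] => /negbT/forallPn[[[c r] cU]] /=.
have e := U _ _ cU; subst r; rewrite -ltnNge => bc.
by case: (lb c bc); apply/upper_unpairedP.
Qed.

Lemma before_lower i D b r k : raises_at i D b ->
  before (lower_cell i D b) r k + ((r == i.+1) && (b < k)) =
  before D r k + ((r == i) && (b < k)).
Proof.
move=> /raises_at_in[h1 h2]; elim: k => [|k IH]; first by rewrite !before0 !ltn0 !andbF.
rewrite !beforeS !inE !xpair_eqE.
have [e|nk] /= := eqVneq k b; last by move: nk IH; clear; lia.
subst k; move: IH; rewrite ltnn ltnSn !andbF !andbT.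
have [->|ni] /= := eqVneq r i; first by rewrite (negbTE h2); clear; lia.
have [->|ni1] /= := eqVneq r i.+1; last by clear; lia.
by rewrite h1; clear; lia.
Qed.

(** The changed column is the last global minimum of the height of the image, hence determined by
    it. This yields the uniqueness of the lowering. *)
Lemma raise_diagram_inj i D1 D2 D : 
  raise_diagram i D1 = Some D -> raise_diagram i D2 = Some D -> D1 = D2.
Proof.
move=> /raise_diagramP[b1 R1 e1] /raise_diagramP[b2 R2 e2].
have E1 r k := before_lower r k R1; have E2 r k := before_lower r k R2.
rewrite -e1 in E1; rewrite -e2 in E2.
have eb : b1 = b2.
  have [[u1 l1] [u2 l2]] := (R1, R2).
  have [lt|lt|//] := ltngtP b1 b2.
  - have := l1 b2 lt; have := u1 b1 (leqnn _); have := u2 b1 (ltnW lt).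
    have := u2 b2 (leqnn _); move: (E1 i b2) (E1 i.+1 b2) (E2 i b2) (E2 i.+1 b2).
    move: (E1 i b1) (E1 i.+1 b1) (E2 i b1) (E2 i.+1 b1).
    move: (raises_at_in R1) (raises_at_in R2); rewrite !beforeS => -[-> /negbTE->] [-> /negbTE->]; lia.
  - have := l2 b1 lt; have := u2 b2 (leqnn _); have := u1 b2 (ltnW lt).
    have := u1 b1 (leqnn _); move: (E1 i b2) (E1 i.+1 b2) (E2 i b2) (E2 i.+1 b2).
    move: (E1 i b1) (E1 i.+1 b1) (E2 i b1) (E2 i.+1 b1).
    move: (raises_at_in R1) (raises_at_in R2); rewrite !beforeS => -[-> /negbTE->] [-> /negbTE->]; lia.
subst b2; apply/fsetP => -[c r].
have [h1 /negbTE n1] := raises_at_in R1; have [h2 /negbTE n2] := raises_at_in R2.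
move: e1; rewrite e2 => /fsetP /(_ (c, r)); rewrite !inE !xpair_eqE.
have [->|_] /= := eqVneq c b1; last by move=> ->.
have [->|_] /= := eqVneq r i; first by rewrite n1 n2.
have [->|_] /= := eqVneq r i.+1; first by rewrite h1 h2.
by move=> ->.
Qed.

(** * Moving cells between adjacent columns *)

(* Horizontally, a cell of column [c] is paired with the nearest available cell
   weakly below it in column [c.+1].  [slack N D c r] is the number of cells of
   column [c] in rows [>= r] still waiting for a partner; the truncated
   subtraction discards the cells of column [c.+1] that find none. *)
Fixpoint carry (X Y : nat -> bool) (k r : nat) : nat :=
  if k is k'.+1 then carry X Y k' r.+1 + X r - Y r else 0.

Definition slack (N : nat) (D : diagram) (c r : nat) : nat :=
  carry (fun r => (c, r) \in D) (fun r => (c.+1, r) \in D) (N.+1 - r) r.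

(** A horizontally unpaired cell of column [c.+1]: no cell of column [c] weakly above it still waits
    for a partner. The bound keeps [r] among the rows that [slack] scans. *)
Definition free (N : nat) (D : diagram) (c r : nat) : bool :=
  [&& r <= N, (c.+1, r) \in D & slack N D c r.+1 + ((c, r) \in D) == 0].

(** The union with the projections to column [c] only provides a finite set of candidate cells. *)
Definition shift (N c : nat) (D : diagram) : diagram :=
  [fset z in D `|` [fset (c, row z) | z in D] |
    if col z == c then (z \in D) || free N D c (row z)
    else if col z == c.+1 then (z \in D) && ~~ free N D c (row z)
    else z \in D].

Lemma slackE N D c r : r <= N ->
  slack N D c r = slack N D c r.+1 + ((c, r) \in D) - ((c.+1, r) \in D).
Proof. by move=> rN; rewrite /slack subSn. Qed.

Lemma slack_gt N D c r : N < r -> slack N D c r = 0.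
Proof. by rewrite /slack -subn_eq0 => /eqP ->. Qed.

Lemma in_shift N c D d r : ((d, r) \in shift N c D) =
  if d == c then ((d, r) \in D) || free N D c r
  else if d == c.+1 then ((d, r) \in D) && ~~ free N D c r
  else (d, r) \in D.
Proof.
rewrite !inE /col /row /=; case: eqVneq => [->|dc]; last first.
  by case: eqVneq => [_|dc1]; case: ((d, r) \in D); rewrite ?andbF // ?orbT ?andTb.
case: (boolP ((c, r) \in D)) => //= _.
case: (boolP (free N D c r)) => [fr|]; rewrite ?andbF // andbT.
by apply/imfsetP; exists (c.+1, r) => //; case/and3P: fr.
Qed.

Lemma free_in N D c r : free N D c r -> (c.+1, r) \in D /\ (c, r) \notin D.
Proof. by case/and3P=> _ ->; case: (_ \in _) => //; rewrite addn1. Qed.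

Lemma before_shift N c D i b : before (shift N c D) i b =
  before D i b + (free N D c i && (b == c.+1)).
Proof.
elim: b => [|b IH]; first by rewrite !before0 andbF.
rewrite !beforeS IH in_shift eqSS.
case: (boolP (free N D c i)) => [/free_in[h1 /negbTE h2]|_] /=; last first.
  by rewrite orbF andbT !if_same !addn0.
case: (eqVneq b c) => [->|nc]; first by rewrite h2 (ltn_eqF (ltnSn c)) addn0.
by case: (eqVneq b c.+1) => [->|ncS]; rewrite ?h1 ?addn0.
Qed.

Lemma wt_shift N c D r :
  #|` [fset x in shift N c D | row x == r] | = #|` [fset x in D | row x == r] |.
Proof.
have mS (E : diagram) d s :
    ((d, s) \in [fset x in E | row x == r]) = ((d, s) \in E) && (s == r).
  by rewrite !inE.
case: (boolP (free N D c r)) => [fr|nfr]; last first.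
  congr (#|` _|); apply/fsetP => -[d s]; rewrite !mS in_shift.
  have [->|_] := eqVneq s r; last by rewrite !andbF.
  by rewrite (negbTE nfr) orbF !andbT !if_same.
have [h1 h2] := free_in fr.
set S := [fset x in D | row x == r].
have -> : [fset x in shift N c D | row x == r] = (c, r) |` (S `\ (c.+1, r)).
  apply/fsetP => -[d s]; rewrite mS in_shift in_fset1U in_fsetD1 mS !xpair_eqE.
  have [->|ns] := eqVneq s r; rewrite ?andbF // !andbT fr orbT andbF.
  by case: eqP => // _; case: eqP.
rewrite cardfsU1 in_fsetD1 mS (negbTE h2) andbF.
by rewrite (cardfsD1 (c.+1, r) S) mS h1 eqxx.
Qed.

Lemma slack_eq N D D' c r :
  (forall k, r <= k -> ((c, k) \in D) = ((c, k) \in D') /\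
                       ((c.+1, k) \in D) = ((c.+1, k) \in D')) ->
  slack N D c r = slack N D' c r.
Proof.
rewrite /slack; move: (N.+1 - r) => n; elim: n r => //= n IH r H.
by have [-> ->] := H r (leqnn r); rewrite (IH r.+1) // => k rk; apply: H; apply: ltnW.
Qed.

Lemma in_lower i D b d r : ((d, r) \in lower_cell i D b) =
  if d == b then if r == i then true else (r != i.+1) && ((d, r) \in D)
  else (d, r) \in D.
Proof.
by rewrite !inE !xpair_eqE; case: (d == b) => //=; case: (r == i).
Qed.

(* Pairing in rows other than [i] and [i.+1] sees the same slack before and
   after the move, so only a two by two submatrix matters. *)
Lemma shift_raise N c i D b : i < N -> raises_at i D b ->
  exists2 b', raises_at i (shift N c D) b' &
    shift N c (lower_cell i D b) = lower_cell i (shift N c D) b'.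
Proof.
move=> iN R; have [h1 /negbTE h2] := raises_at_in R.
set D' := lower_cell i D b.
have mD' := in_lower i D b.
have up k : i.+1 < k -> slack N D' c k = slack N D c k.
  move=> ik; apply: slack_eq => s ks; rewrite !mD'.
  have -> : s == i = false by move: ks ik; clear; lia.
  have -> : s == i.+1 = false by move: ks ik; clear; lia.
  by split; case: ifP.
have f1 : free N D c i.+1 =
    ((c.+1, i.+1) \in D) && (slack N D c i.+2 + ((c, i.+1) \in D) == 0).
  by rewrite /free iN.
have f1' : free N D' c i.+1 =
    ((c.+1, i.+1) \in D') && (slack N D c i.+2 + ((c, i.+1) \in D') == 0).
  by rewrite /free iN up.
have f0 : free N D c i = ((c.+1, i) \in D) &&
    (slack N D c i.+2 + ((c, i.+1) \in D) - ((c.+1, i.+1) \in D) + ((c, i) \in D) == 0).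
  by rewrite /free ltnW // (slackE _ _ iN).
have f0' : free N D' c i = ((c.+1, i) \in D') &&
    (slack N D c i.+2 + ((c, i.+1) \in D') - ((c.+1, i.+1) \in D') + ((c, i) \in D') == 0).
  by rewrite /free ltnW // (slackE _ _ iN) up.
(* Only truncation could make the two differ, and the height conditions exclude it: if [b] is [c],
   an upper cell in column [c.+1] has a lower one beneath it; if [b] is [c.+1], a lower cell in
   column [c] has an upper one above it. *)
have same : slack N D' c i = slack N D c i.
  rewrite !(slackE _ _ (ltnW iN)) !(slackE _ _ iN) up // !mD' eqxx.
  have [u l] := R.
  have uc := u c; have lc2 := l c.+2.
  rewrite !beforeS in uc lc2.
  have -> : i.+1 == i = false by clear; lia.
  have [e|nc] := eqVneq c b.
    subst b; have -> : c.+1 == c = false by clear; lia.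
    move: lc2; rewrite eqxx h1 h2; clear; lia.
  have [e|nc1] := eqVneq c.+1 b; last by [].
  subst b; move: uc; rewrite ?beforeS h1 h2 ?eqxx; clear; lia.
have down k : k <= i -> slack N D' c k = slack N D c k.
  move=> /subnKC; move: (i - k) => m; elim: m k => [|m IH] k e.
    by rewrite addn0 in e; rewrite e.
  have kN : k <= N by move: e iN; clear; lia.
  rewrite !(slackE _ _ kN) IH ?addSnnS // !mD'.
  have -> : k == i = false by move: e; clear; lia.
  have -> : k == i.+1 = false by move: e; clear; lia.
  by rewrite !if_same.
have fr k : k != i -> k != i.+1 -> free N D' c k = free N D c k.
  move=> ki ki1; rewrite /free !mD' (negbTE ki) ki1 /= !if_same.
  have [lt|ge] := ltnP k i; first by rewrite down.
  by rewrite up //; move: ge ki; clear; lia.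
have facts d :
    [/\ d <= b ->
        before D i b.+1 + before D i.+1 d < before D i d + before D i.+1 b.+1
      & b < d ->
        before D i b.+1 + before D i.+1 d <= before D i d + before D i.+1 b.+1].
  by have [u l] := R; split; [apply: u|apply: l].
have Fc r := beforeS D r c; have Fc1 r := beforeS D r c.+1.
have [Rc Rc1 Rc2] := And3 (facts c) (facts c.+1) (facts c.+2).
(* The column changes in two cases: a free cell of row [i] comes to occupy the target [(c, i)], so
   that column [c.+1] takes over; or the cell to be moved, in column [c.+1], is itself free and has
   gone to column [c]. *)
pose b' := if (b == c) && free N D c i then c.+1
           else if (b == c.+1) && free N D c i.+1 then c else b.
exists b'.
  suff H d : [/\ d <= b' -> before (shift N c D) i b'.+1 + before (shift N c D) i.+1 d
                      < before (shift N c D) i d + before (shift N c D) i.+1 b'.+1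
    & b' < d -> before (shift N c D) i b'.+1 + before (shift N c D) i.+1 d
                      <= before (shift N c D) i d + before (shift N c D) i.+1 b'.+1].
    by split=> d; [case: (H d)|case: (H d)].
  have Rd := facts d.
  have Fb r := beforeS D r b.
  move: (Fc i) (Fc i.+1) (Fc1 i) (Fc1 i.+1) (Fb i) (Fb i.+1); rewrite !before_shift /b' f0 f1.
  move: Rc Rc1 Rc2 Rd; rewrite h1 h2; move: (slack N D c i.+2) => W.
  move=> [Rc Rc'] [Rc1 Rc1'] [Rc2 Rc2'] [Rd Rd'].
  have WE n : (W + n.+1 == 0) = false by rewrite addnS.
  have [eb|nbc] := eqVneq b c.
    subst b; have -> : c == c.+1 = false by clear; lia.
    rewrite h1 h2; move: WE Rc Rc1 Rc2 Rd Rc' Rc1' Rc2' Rd'; clear.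
    case: ((c.+1, i) \in D) => /=; case: ((c.+1, i.+1) \in D) => /= WE; rewrite ?WE /=.
    - have [->|W0] /= := eqVneq W 0; rewrite ?eqxx /=.
      have [->|dc] := eqVneq d c.+1; [lia|].
      rewrite ?addn0; lia.
      have -> : (W + 1 - 1 + 0 == 0) = false by lia.
      rewrite /= ?addn0; lia.
    - rewrite subn0 !addn0 WE /= !addn0; lia.
    - rewrite /= !addn0; lia.
    - rewrite /= !addn0; lia.
  have [eb|nbc1] := eqVneq b c.+1.
    subst b; rewrite h1 h2; move: WE Rc Rc1 Rc2 Rd Rc' Rc1' Rc2' Rd'; clear.
    case: ((c, i) \in D) => /=; case: ((c, i.+1) \in D) => /= WE; rewrite ?WE /=.
    - rewrite !addn0; lia.
    - rewrite !addn0; lia.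
    - rewrite !addn0; lia.
    - rewrite !addn0; case/orP: (orbN (W == 0)) => W0;
        rewrite ?W0 ?(negbTE W0) /=; last by lia.
      rewrite eqxx; have [->|dc] := eqVneq d c.+1; lia.
  rewrite !eqSS (negbTE nbc) /=; move: nbc nbc1 WE Rc Rc1 Rc2 Rd Rc' Rc1' Rc2' Rd'; clear.
  case: ((c, i) \in D) => /=; case: ((c, i.+1) \in D) => /=;
  case: ((c.+1, i) \in D) => /=; case: ((c.+1, i.+1) \in D) => /= nbc nbc1 WE;
  rewrite ?WE /= ?addn0 ?andbF;
  have [->|dc] := eqVneq d c.+1; rewrite ?andbT ?andbF ?addn0; lia.
have Kc : b = c -> ((c.+1, i.+1) \in D) ==> ((c.+1, i) \in D).
  move=> e; subst b; case: Rc2 => _ /(_ (leqnSn _)); rewrite !beforeS h1 h2.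
  by case: (_ \in _); case: (_ \in _) => //; clear; lia.
have Kc1 : b = c.+1 -> ((c, i) \in D) ==> ((c, i.+1) \in D).
  move=> e; subst b; case: Rc => /(_ (leqnSn _)) + _.
  rewrite !beforeS h1 h2.
  by case: (_ \in _); case: (_ \in _) => //; clear; lia.
apply/fsetP => -[d r]; rewrite in_shift [in RHS]in_lower [in RHS]in_shift.
case/orP: (orbN ((r == i) || (r == i.+1))) => [|]; last first.
  rewrite negb_or => /andP[ri ri1].
  rewrite fr // mD' (negbTE ri) ri1 /=.
  by case: (_ == b); case: (_ == b').
have ii : (i == i.+1) = false by clear; lia.
have ii' : (i.+1 == i) = false by clear; lia.
have cc : (c == c.+1) = false by clear; lia.
have cc' : (c.+1 == c) = false by clear; lia.
rewrite /b'; case/orP => /eqP ->; rewrite ?(f0, f1, f0', f1') !mD' ?eqxx ?ii ?ii' /=.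
all: have [eb|nbc] := eqVneq b c; [subst b; move: Kc => /(_ erefl) | 
     have [eb|nbc1] := eqVneq b c.+1; [subst b; move: Kc1 => /(_ erefl) | ]].
all: rewrite ?eqxx ?cc ?cc' ?h1 ?h2 /=.
all: try by have [->|db] := eqVneq d b; rewrite ?(negbTE nbc) ?(negbTE nbc1).
all: move: (slack N D c i.+2) => W.
all: have [->|dc] := eqVneq d c; [|have [->|dc1] := eqVneq d c.+1].
all: rewrite ?(negbTE dc) ?(negbTE dc1) ?cc ?cc' ?h1 ?h2 ?eqxx /=.
all: try move: (negbTE dc) (negbTE dc1).
all: move: cc cc'; clear => cc cc'; case: ((c, i) \in D) => //=;
  case: ((c, i.+1) \in D) => //=; case: ((c.+1, i) \in D) => //=;
  case: ((c.+1, i.+1) \in D) => //=; case: W => [|W] //=;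
  rewrite ?addn0 ?addn1 ?subn0 ?subn1 /= ?eqxx ?cc ?cc' //=.
all: by move=> dc dc1; rewrite ?dc ?dc1.
Qed.

Lemma slack_carry N c D D' r : r <= N ->
  slack N D c r = slack N D' c r ->
  (forall d, ((d, r) \in shift N c D) = ((d, r) \in shift N c D')) ->
  slack N D c r.+1 = slack N D' c r.+1 /\ free N D c r = free N D' c r.
Proof.
move=> rN; rewrite !(slackE _ _ rN) => e H; move: (H c) (H c.+1) e; rewrite !in_shift.
have -> : (c.+1 == c) = false by clear; lia.
rewrite !eqxx /free rN /=.
move: (slack N D c r.+1) (slack N D' c r.+1) => W W'; clear.
by case: ((c, r) \in D); case: ((c.+1, r) \in D); case: ((c, r) \in D');
  case: ((c.+1, r) \in D') => /=; rewrite ?addn1 ?addn0 ?subn1 ?subn0 //=;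
  case: W => [|W]; case: W' => [|W'] //=; clear; lia.
Qed.

(** Slack 0 at the bottom means that no cell of column [c] stays unpaired. From this common value
    [slack_carry] recovers the slack and the free cells row by row upwards. *)
Lemma shift_inj N c D D' : slack N D c 0 = 0 -> slack N D' c 0 = 0 ->
  shift N c D = shift N c D' -> D = D'.
Proof.
move=> s s' e; have H r d : ((d, r) \in shift N c D) = ((d, r) \in shift N c D').
  by rewrite e.
have sl r : r <= N -> slack N D c r = slack N D' c r.
  elim: r => [|r IH] rN; first by rewrite s s'.
  by have [] := slack_carry (ltnW rN) (IH (ltnW rN)) (H r).
have fr r : free N D c r = free N D' c r.
  have [rN|Nr] := leqP r N; first by have [] := slack_carry rN (sl r rN) (H r).
  by rewrite /free leqNgt Nr.
apply/fsetP => -[d r]; have := H r d; rewrite !in_shift -fr.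
have [->|dc] := eqVneq d c.
  case: (boolP (free N D c r)) => [f|_]; last by rewrite !orbF.
  have [_ /negbTE->] := free_in f.
  by move: f; rewrite fr => /free_in[_ /negbTE->].
have [->|//] := eqVneq d c.+1.
case: (boolP (free N D c r)) => [f|_]; last by rewrite !andbT.
have [-> _] := free_in f.
by move: f; rewrite fr => /free_in[-> _].
Qed.

End Diagrams.

(** * Labelings of diagrams *)

(* Label [i] occurs in column [c] when [g c < a_i]: key tableaux correspond to
   [g c = c - 1] and lock tableaux to [g c = M - c], and reflecting two columns
   exchanges two values of [g]. *)
Definition occ (n : nat) (a : n.-tuple nat) (g : nat -> nat) (i : 'I_n) (c : nat) :=
  (0 < c) && (g c < tnth a i).

(** [rho i c] is the row of label [i.+1] in column [c], meaningful only where [occ] holds. The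
    clauses are K2 with positive rows, at most one label per cell, and K3. *)
Definition labeling (n : nat) (a : n.-tuple nat) (g : nat -> nat)
    (rho : 'I_n -> nat -> nat) : Prop :=
  [/\ forall (i : 'I_n) c, occ a g i c -> 0 < rho i c <= i.+1,
      forall (i j : 'I_n) c, occ a g i c -> occ a g j c -> rho i c = rho j c -> i = j
    & forall (i : 'I_n) c c', c < c' -> occ a g i c -> occ a g i c' ->
        rho i c' <= rho i c].

Definition fills (n : nat) (a : n.-tuple nat) (g : nat -> nat)
    (rho : 'I_n -> nat -> nat) (D : diagram) : Prop :=
  forall c r, (c, r) \in D <-> exists2 i : 'I_n, occ a g i c & rho i c = r.

Definition swap_labels (n : nat) (i j : 'I_n) (u v : nat)
    (rho : 'I_n -> nat -> nat) : 'I_n -> nat -> nat :=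
  fun k c => if u <= c <= v then rho (tperm i j k) c else rho k c.

(** The label [j] receives the higher rows: [rho i c <= j.+1] preserves K2 for it, and the last two
    clauses preserve K3 across the left and right ends of the range. *)
Definition exchangeable (n : nat) (a : n.-tuple nat) (g : nat -> nat)
    (rho : 'I_n -> nat -> nat) (i j : 'I_n) (u v : nat) : Prop :=
  [/\ forall c, u <= c <= v ->
        [&& occ a g i c, occ a g j c, rho j c < rho i c & rho i c <= j.+1],
      forall c c', c < u -> u <= c' <= v -> occ a g j c -> rho i c' <= rho j c
    & forall c c', u <= c <= v -> v < c' -> occ a g i c' -> rho i c' <= rho j c].

Lemma occ_swap n (a : n.-tuple nat) g rho i j u v k c :
  exchangeable a g rho i j u v -> u <= c <= v ->
  occ a g (tperm i j k) c = occ a g k c.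
Proof.
case=> H _ _ /H /and4P[oi oj _ _].
by case: tpermP => [->|->|]; rewrite ?oi ?oj.
Qed.

Lemma labeling_swap n (a : n.-tuple nat) g rho i j u v :
  exchangeable a g rho i j u v -> labeling a g rho ->
  labeling a g (swap_labels i j u v rho).
Proof.
move=> ex [L1 L2 L3]; have oS := @occ_swap _ _ _ _ _ _ _ _ _ _ ex.
case: ex => H Hl Hr; split.
- move=> k c ok; rewrite /swap_labels; case: ifP => [uv|_]; last exact: L1.
  have /and4P[oi oj lt le] := H c uv.
  have := L1 i c oi; have := L1 j c oj; have := L1 k c ok.
  case: tpermP => [->|->|]; lia.
- move=> k l c ok ol; rewrite /swap_labels; case: ifP => [uv|_]; last exact: L2.
  by move=> /L2; rewrite !oS // => /(_ ok ol) /perm_inj.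
move=> k c c' cc' oc oc'; rewrite /swap_labels.
case: ifP => [uv'|nuv']; case: ifP => [uv|nuv].
- by apply: L3; rewrite ?oS.
- have cu : c < u by lia.
  have /and4P[oi oj lt le] := H c' uv'.
  case: tpermP oc => [->|->|_ _] oc; last exact: L3.
    exact: leq_trans (ltnW lt) (L3 _ _ _ cc' oc oi).
  exact: Hl.
- have vc : v < c' by lia.
  have /and4P[oi oj lt le] := H c uv.
  case: tpermP oc' => [->|->|_ _] oc'; last exact: L3.
    exact: Hr.
  exact: leq_trans (L3 _ _ _ cc' oj oc') (ltnW lt).
exact: L3.
Qed.

Lemma fills_swap n (a : n.-tuple nat) g rho i j u v D :
  exchangeable a g rho i j u v -> fills a g rho D ->
  fills a g (swap_labels i j u v rho) D.
Proof.
move=> ex F c r; rewrite F /swap_labels; case: (boolP (u <= c <= v)) => // uv.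
split=> -[k ok e]; exists (tperm i j k); rewrite ?(occ_swap _ ex) //.
by rewrite tpermK.
Qed.

(** * Ascent by exchanges of labels *)

Definition potential (n B : nat) (w rho : 'I_n -> nat -> nat) : nat :=
  \sum_(c < B) \sum_(k < n) w k c * rho k c.

Lemma rearrangement n (w v : 'I_n -> nat) (i j : 'I_n) : i != j ->
  w i <= w j -> v j <= v i ->
  \sum_k w k * v (tperm i j k) = \sum_k w k * v k + (w j - w i) * (v i - v j).
Proof.
move=> ij wij vij.
rewrite (bigD1 i) // (bigD1 j) 1?eq_sym //= tpermL tpermR.
rewrite [in RHS](bigD1 i) // [in RHS](bigD1 j) 1?eq_sym //=.
rewrite (eq_bigr (fun k => w k * v k)).
  by rewrite -(subnK wij) -(subnK vij); nia.
by move=> k /andP[ki kj]; rewrite tpermD // eq_sym.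
Qed.

(** In each column of the range the higher row passes to a label of no smaller weight; column [m]
    makes the gain strict. *)
Lemma potential_swap n (w rho : 'I_n -> nat -> nat) (i j : 'I_n) u v B m :
  (forall c, u <= c <= v -> rho j c < rho i c /\ w i c <= w j c) ->
  u <= m <= v -> m < B -> w i m < w j m ->
  potential B w rho < potential B w (swap_labels i j u v rho).
Proof.
move=> H um mB wm; have [rm _] := H m um.
have ij : i != j by apply: contraTneq rm => ->; rewrite ltnn.
have colE c : u <= c <= v -> \sum_(k < n) w k c * swap_labels i j u v rho k c =
    \sum_(k < n) w k c * rho k c + (w j c - w i c) * (rho i c - rho j c).
  move=> uv; rewrite /swap_labels uv; have [lt le] := H c uv.
  by apply: (@rearrangement _ (w^~ c) (rho^~ c)) => //; apply: ltnW.
rewrite /potential (bigD1 (Ordinal mB)) //= [X in _ < X](bigD1 (Ordinal mB)) //=.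
rewrite colE // -addSn leq_add //.
  by rewrite -addn1 leq_add2l muln_gt0 !subn_gt0 wm.
apply: leq_sum => c _; case: (boolP (u <= c <= v)) => uv.
  by rewrite colE // leq_addr.
by rewrite /swap_labels (negbTE uv).
Qed.

Lemma potential_le n (w rho : 'I_n -> nat -> nat) B N :
  (forall k c, 0 < w k c -> rho k c <= N) ->
  potential B w rho <= \sum_(c < B) \sum_(k < n) w k c * N.
Proof.
move=> H; apply: leq_sum => c _; apply: leq_sum => k _.
by case: (posnP (w k c)) => [->//|/H le]; rewrite leq_mul2l le orbT.
Qed.

Lemma climb (T : Type) (P Q : T -> Prop) (f : T -> nat) (B : nat) :
  (forall x, P x -> f x <= B) ->
  (forall x, P x -> Q x \/ exists2 y, P y & f x < f y) ->
  forall x, P x -> exists2 y, P y & Q y.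
Proof.
move=> fB step x; have [m] := ubnP (B - f x).
elim: m x => // m IH x le Px; have [Qx|[y Py lt]] := step x Px; first by exists x.
by apply: (IH y) => //; have := fB y Py; lia.
Qed.

(* No label [j] occurring in both columns can be raised in column [c.+1] by an
   exchange with a label [p] that has to move to column [c]. *)
Definition tight (n : nat) (a : n.-tuple nat) (g : nat -> nat)
    (rho : 'I_n -> nat -> nat) (c : nat) : Prop :=
  forall p j : 'I_n, occ a g p c.+1 -> tnth a p <= g c < tnth a j ->
    rho j c.+1 < rho p c.+1 -> rho j c < rho p c.+1.

(** A label that occurs in column [c.+1] but not in column [c] then fills all columns from [c.+1] to
    [e] and none beyond [e]. *)
Definition sortable (g : nat -> nat) (c : nat) : Prop :=
  [/\ 0 < c, g c.+1 < g c
    & exists e, (forall d, c < d <= e -> g d <= g c.+1) /\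
                (forall d, e < d -> g c <= g d)].

Lemma exchange_tight n (a : n.-tuple nat) g rho c (p j : 'I_n) B :
  (forall i d, occ a g i d -> d <= B) -> sortable g c -> labeling a g rho ->
  occ a g p c.+1 -> tnth a p <= g c < tnth a j ->
  rho j c.+1 < rho p c.+1 -> rho p c.+1 <= rho j c ->
  exists2 v, c < v & exchangeable a g rho p j c.+1 v.
Proof.
move=> hB [c0 gc [e [ge1 ge2]]] [L1 L2 L3] op /andP[pg gj] lt le.
have oj d : occ a g p d -> occ a g j d.
  by move=> /andP[d0 dp]; rewrite /occ d0 (leq_trans dp) // ltnW // (leq_ltn_trans pg).
have ojc : occ a g j c by rewrite /occ c0.
(* The exchange extends up to the column before the first one where [p] is absent or no longer above
   [j]. *)
pose bad d := (c.+1 < d) && ~~ (occ a g p d && (rho j d < rho p d)).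
have : exists d, bad d.
  exists (maxn B.+1 c.+2); rewrite /bad leq_maxr /=; apply/negP => /andP[/hB].
  lia.
move=> /ex_minnP[m /andP[cm nm] min].
have good d : c.+1 <= d <= m.-1 -> occ a g p d && (rho j d < rho p d).
  move=> /andP[]; rewrite leq_eqVlt => /orP[/eqP<- _|cd dm]; first by rewrite op.
  apply/negPn/negP => nd; have := min d; rewrite /bad cd nd => /(_ isT).
  lia.
have jc d : c.+1 <= d <= m.-1 -> rho p d <= rho j c.
  move=> dm; have /andP[od _] := good d dm; apply: leq_trans le.
  case/andP: dm; rewrite leq_eqVlt => /orP[/eqP<- //|cd _].
  exact: L3 cd op od.
exists m.-1; first lia.
split.
- move=> d dm; have /andP[od ->] := good d dm; rewrite od oj //=.
  by apply: leq_trans (jc d dm) _; have /andP[] := L1 j c ojc.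
- move=> d d' dc dm ojd; apply: leq_trans (jc d' dm) _.
  by move: dc; rewrite ltnS leq_eqVlt => /orP[/eqP->//|dc]; apply: L3 dc ojd ojc.
move=> d d' dm md opd'.
(* To the right of [c] the columns of [p] are consecutive, so [p] is present at [m] if it occurs
   further right; it is then weakly below [j] there. *)
have opm : occ a g p m.
  move: opd' op; rewrite /occ => /andP[_ pd'] /andP[_ pc].
  have := ge1 m; have := ge2 m; have := ge2 d'; lia.
have pjm : rho p m <= rho j m.
  by move: nm; rewrite opm /= -leqNgt.
have /andP[od _] := good d dm.
apply: (@leq_trans (rho p m)).
  have [->//|md'] : d' = m \/ m < d' by lia.
  exact: L3 md' opm opd'.
apply: leq_trans pjm _; apply: (L3 j d m); rewrite ?oj //; lia.
Qed.

(** The potential is the sum of the rows in column [c.+1] of the labels that occur in column [c] as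
    well. A failure of tightness permits an exchange that raises one of them. *)
Lemma tight_labeling n (a : n.-tuple nat) g rho c B D :
  (forall i d, occ a g i d -> d <= B) -> sortable g c ->
  labeling a g rho -> fills a g rho D ->
  exists2 rho', labeling a g rho' /\ fills a g rho' D & tight a g rho' c.
Proof.
move=> hB sc L F; pose w (k : 'I_n) d := ((d == c.+1) && (g c < tnth a k) : nat).
have gc : g c.+1 < g c by case: sc.
apply: (@climb _ (fun rho => labeling a g rho /\ fills a g rho D) _
  (potential c.+2 w) (\sum_(d < c.+2) \sum_(k < n) w k d * n)) (conj L F).
  move=> {L F} rho [[L1 _ _] F]; apply: potential_le => k d.
  rewrite /w; case: eqP => //= ->; rewrite lt0b => gk.
  have /andP[_ le] := L1 k c.+1 (ltn_trans gc gk).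
  by apply: leq_trans le (ltn_ord k).
move=> {L F} rho [L F]; case: (pselect (exists p j : 'I_n,
  [/\ occ a g p c.+1, tnth a p <= g c < tnth a j,
      rho j c.+1 < rho p c.+1 & rho p c.+1 <= rho j c])) => [[p [j [op pj lt le]]]|no].
  have [v cv ex] := exchange_tight hB sc L op pj lt le.
  right; exists (swap_labels p j c.+1 v rho).
    by split; [apply: labeling_swap | apply: fills_swap].
  have /andP[pg gj] := pj; have pgF : (g c < tnth a p) = false by rewrite ltnNge pg.
  apply: (@potential_swap _ _ _ _ _ _ _ _ c.+1) => //.
  - move=> d dv; case: ex => /(_ d dv)/and4P[_ _ -> _] _ _; split=> //.
    by rewrite /w pgF andbF.
  - by rewrite leqnn.
  - by rewrite /w eqxx gj pgF.
left=> p j op pj lt; rewrite ltnNge; apply/negP => le.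
by apply: no; exists p, j.
Qed.

Lemma sum_flip n (F G : 'I_n -> nat) (b : bool) :
  (b -> exists2 k0, F k0 = (G k0).+1 & forall k, k != k0 -> F k = G k) ->
  (~~ b -> F =1 G) -> \sum_k F k = \sum_k G k + b.
Proof.
case: b => [/(_ isT)[k0 e ne] _|_ /(_ isT) e]; last first.
  by rewrite addn0; apply: eq_bigr => k _; apply: e.
rewrite (bigD1 k0) //= [in RHS](bigD1 k0) //= e (eq_bigr G) //; lia.
Qed.

(** * The reflection of two columns under a tight labeling *)

Section Reflection.

Variables (n : nat) (a : n.-tuple nat) (g : nat -> nat).
Variables (rho : 'I_n -> nat -> nat) (c : nat) (D : diagram).
Hypotheses (sc : sortable g c) (L : labeling a g rho) (F : fills a g rho D).
Hypothesis (T : tight a g rho c).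

(* [crossing r] counts the labels whose cells in columns [c] and [c.+1] are
   separated by the line just below row [r]; it will be equal to the slack. *)
Let crossing r := \sum_(k < n) ((g c < tnth a k) && (rho k c.+1 < r <= rho k c)).
Let meeting r := \sum_(k < n) ((g c < tnth a k) && (rho k c.+1 <= r <= rho k c)).

Lemma occ_left (k : 'I_n) : g c < tnth a k -> occ a g k c /\ occ a g k c.+1.
Proof. by case: sc => c0 gc _ gk; rewrite /occ c0 gk (ltn_trans gc). Qed.

Lemma occ_leftE (k : 'I_n) : occ a g k c = (g c < tnth a k).
Proof. by case: sc => c0 _ _; rewrite /occ c0. Qed.

(** [meeting r] exceeds [crossing r.+1] by the label with its cell of column [c] in row [r], and
    [crossing r] by the one with its cell of column [c.+1] there. Together these give the recursion
    of the slack. *)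
Lemma crossingS r : meeting r = crossing r.+1 + ((c, r) \in D).
Proof.
have [L1 L2 L3] := L.
apply: sum_flip => [/F[k0 ok0 e]|no k].
  exists k0 => [|k kk0].
    have [_ ok1] : occ a g k0 c /\ occ a g k0 c.+1 by apply: occ_left; rewrite -occ_leftE.
    have := L3 k0 c c.+1 (ltnSn c) ok0 ok1; rewrite occ_leftE in ok0; rewrite ok0; lia.
  case: ltnP => //= gk; have : rho k c <> r.
    by move=> ek; case/eqP: kk0; apply: L2 ok0 _; rewrite ?occ_leftE // ek.
  lia.
case: ltnP => //= gk; have : rho k c <> r.
  by move=> ek; case/negP: no; apply/F; exists k; rewrite ?occ_leftE.
lia.
Qed.

Lemma meetingE r : meeting r =
  crossing r + [exists k : 'I_n, (g c < tnth a k) && (rho k c.+1 == r)].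
Proof.
have [L1 L2 L3] := L.
apply: sum_flip => [/existsP[k0 /andP[gk0 /eqP e]]|/existsPn no k].
  have [ok0 ok1] := occ_left gk0.
  exists k0 => [|k kk0].
    by have := L3 k0 c c.+1 (ltnSn c) ok0 ok1; rewrite gk0; lia.
  case: ltnP => //= gk; have [_ ok] := occ_left gk; have : rho k c.+1 <> r.
    by move=> ek; case/eqP: kk0; apply: L2 ok ok1 _; rewrite ek.
  lia.
by have := no k; case: ltnP => //= gk; lia.
Qed.

(** Here tightness enters: a label of both columns that is below [p] in column [c.+1] is also below
    that row in column [c]. *)
Lemma meeting0 (p : 'I_n) : occ a g p c.+1 -> tnth a p <= g c ->
  meeting (rho p c.+1) = 0.
Proof.
have [L1 L2 L3] := L => op pg; apply: big1 => k _.
case: ltnP => //= gk; have [_ ok] := occ_left gk.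
have ne : rho k c.+1 <> rho p c.+1.
  by move=> /(L2 _ _ _ ok op) e; rewrite e ltnNge pg in gk.
have := T op (introT andP (conj pg gk)); lia.
Qed.

(** By induction from the top row. A cell of column [c.+1] whose label occurs in column [c] ends one
    crossing; any other cell of column [c.+1] meets slack 0, where the truncated subtraction has no
    effect. *)
Lemma slack_crossing r : r <= n.+1 -> slack n D c r = crossing r.
Proof.
have [L1 L2 L3] := L.
move=> /subnKC; move: (n.+1 - r) => m; elim: m r => [|m IH] r e.
  rewrite slack_gt; last lia.
  rewrite /crossing big1 // => k _; case: ltnP => //= gk.
  have [ok _] := occ_left gk; have := L1 k c ok; have := ltn_ord k; lia.
rewrite slackE; last lia.
rewrite IH; last lia.
rewrite -crossingS; case: (boolP ((c.+1, r) \in D)) => [/F[k ok ek]|no].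
  have [gk|kg] := ltnP (g c) (tnth a k).
    rewrite meetingE; have -> : [exists k : 'I_n, (g c < tnth a k) && (rho k c.+1 == r)].
      by apply/existsP; exists k; rewrite gk ek eqxx.
    by rewrite addn1 subn1.
  have := meeting0 ok kg; rewrite ek meetingE; lia.
rewrite meetingE; case: existsP => [[k /andP[gk /eqP ek]]|_]; last by lia.
by case/negP: no; apply/F; exists k => //; case: (occ_left gk).
Qed.

Lemma free_tight r : free n D c r <->
  exists2 p : 'I_n, occ a g p c.+1 & tnth a p <= g c /\ rho p c.+1 = r.
Proof.
have [L1 L2 L3] := L.
split=> [/and3P[rn /F[p op ep]]|[p op [pg ep]]].
  rewrite slack_crossing // -crossingS meetingE => h; exists p => //; split=> //.
  rewrite leqNgt; apply: contraL h => gp.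
  by rewrite (introT existsP) ?addn1 //; exists p; rewrite gp ep eqxx.
have rn : r <= n by rewrite -ep; have := L1 p _ op; have := ltn_ord p; lia.
rewrite /free rn slack_crossing // -crossingS -ep meeting0 // eqxx andbT.
by apply/F; exists p.
Qed.

Lemma slack0 : slack n D c 0 = 0.
Proof. by rewrite slack_crossing // /crossing big1 // => k _; rewrite ltn0 andbF. Qed.

Let g' d := if d == c then g c.+1 else if d == c.+1 then g c else g d.
Let rho' (k : 'I_n) d := if (d == c) && (tnth a k <= g c) then rho k c.+1 else rho k d.

Let cc : (c == c.+1) = false. Proof. by rewrite ltn_eqF. Qed.
Let cc' : (c.+1 == c) = false. Proof. by rewrite gtn_eqF. Qed.

Lemma occ_sorted (k : 'I_n) d : occ a g' k d ->
  occ a g k d \/ d = c /\ [/\ tnth a k <= g c, occ a g k c.+1 & ~~ occ a g' k c.+1].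
Proof.
case: sc => c0 gc _; rewrite /occ /g' => /andP[d0]; rewrite d0.
have [->|dc] := eqVneq d c; rewrite ?eqxx ?cc ?cc' /=.
  case: (leqP (tnth a k) (g c)) => [kg gk|_ _]; last by left.
  by right.
have [->|dc1] := eqVneq d c.+1; last by left.
by move=> gk; left; apply: ltn_trans gk.
Qed.

Lemma labeling_sorted : labeling a g' rho'.
Proof.
have [L1 L2 L3] := L; have [c0 gc _] := sc.
have sp (k : 'I_n) d : occ a g' k d ->
    occ a g k d /\ rho' k d = rho k d \/
    [/\ d = c, tnth a k <= g c, occ a g k c.+1, ~~ occ a g' k c.+1 & rho' k d = rho k c.+1].
  move=> ok; have [o|[-> [kg o no]]] := occ_sorted ok; last first.
    by right; split=> //; rewrite /rho' eqxx kg.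
  left; split=> //; rewrite /rho'; case: eqP => //= e; subst d.
  by rewrite leqNgt -occ_leftE o.
(* By tightness and K3, a label arriving in column [c] does not collide with one already there. *)
have mixed (k p : 'I_n) : occ a g k c -> tnth a p <= g c -> occ a g p c.+1 ->
    rho k c <> rho p c.+1.
  rewrite occ_leftE => gk pg op e; have [ok ok1] := occ_left gk.
  have ne : rho k c.+1 <> rho p c.+1.
    by move=> /(L2 _ _ _ ok1 op) ekp; rewrite ekp ltnNge pg in gk.
  have := T op (introT andP (conj pg gk)); have := L3 k c c.+1 (ltnSn c) ok ok1; lia.
split.
- by move=> k d /sp[[o ->]|[-> _ o _ ->]]; apply: L1 o.
- move=> k l d /sp[[ok ->]|[ed kg ok _ ->]] /sp[[ol ->]|[ed' lg ol _ ->]].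
  + exact: L2.
  + by subst d => /(mixed _ _ ok lg ol).
  + by subst d => e; case: (mixed _ _ ol kg ok).
  + exact: L2.
move=> k d d' dd' /sp[[o ->]|[ed kg o no ->]] o'; have /sp[[o2 ->]|[ed' lg ol _ ->]] := o'.
- exact: L3 dd' o o2.
- by apply: L3 ol => //; lia.
- apply: L3 o o2; suff : d' <> c.+1 by lia.
  by move=> e; rewrite e (negbTE no) in o'.
- lia.
Qed.

Lemma fills_sorted : fills a g' rho' (shift n c D).
Proof.
have [c0 gc _] := sc.
move=> d r; rewrite in_shift.
have [->|dc] := eqVneq d c.
  have oE (k : 'I_n) : occ a g' k c = occ a g k c.+1 by rewrite /occ /g' eqxx c0.
  split=> [/orP[/F[k ok <-]|/free_tight[p op [pg <-]]]|[k]].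
  - rewrite occ_leftE in ok; exists k; rewrite ?oE; first by case: (occ_left ok).
    by rewrite /rho' eqxx leqNgt ok.
  - by exists p; rewrite ?oE // /rho' eqxx pg.
  rewrite oE /rho' eqxx /= => ok; case: leqP => gk <-; apply/orP.
    by right; apply/free_tight; exists k.
  by left; apply/F; exists k; rewrite ?occ_leftE.
have rE (k : 'I_n) : rho' k d = rho k d by rewrite /rho' (negbTE dc).
have [dc1|dc1] := eqVneq d c.+1; last first.
  have oE (k : 'I_n) : occ a g' k d = occ a g k d.
    by rewrite /occ /g' (negbTE dc) (negbTE dc1).
  by rewrite F; split=> -[k ok e]; exists k; rewrite ?oE ?rE // -?oE -?rE.
subst d; have oE (k : 'I_n) : occ a g' k c.+1 = (g c < tnth a k).
  by rewrite /occ /g' cc' eqxx.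
have [L1 L2 L3] := L.
split=> [/andP[/F[k ok e] nf]|[k]].
  exists k; rewrite ?rE // oE ltnNge; apply: contra nf => kg.
  by apply/free_tight; exists k.
rewrite oE rE => gk e; have [_ ok] := occ_left gk; apply/andP; split.
  by apply/F; exists k.
apply/negP => /free_tight[p op [pg e']].
move: (L2 k p c.+1 ok op); rewrite e e' => /(_ erefl) ekp.
by rewrite ekp ltnNge pg in gk.
Qed.

End Reflection.

(** * Rectification *)

(** A sweep reflects at columns 1, ..., [m] in this order. The sweeps of lengths [e.-1], ..., 0 in
    [rect] spell a reduced word of the longest permutation of [e] columns. *)
Fixpoint sweep (N m : nat) (D : diagram) : diagram :=
  if m is m'.+1 then shift N m (sweep N m' D) else D.

Fixpoint rect (N e : nat) (D : diagram) : diagram :=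
  if e is e'.+1 then rect N e' (sweep N e' D) else D.

Lemma wt_rect N e D r :
  #|` [fset x in rect N e D | row x == r] | = #|` [fset x in D | row x == r] |.
Proof.
elim: e D => //= e IH D; rewrite IH; elim: e {IH} => //= m IH.
by rewrite wt_shift.
Qed.

Lemma rect_raise N e i D D' : i < N -> raise_diagram i D = Some D' ->
  raise_diagram i (rect N e D) = Some (rect N e D').
Proof.
move=> iN; elim: e D D' => //= e IH D D' h; apply: IH; elim: e => //= m.
move=> /raise_diagramP[b R ->]; have [b' R' ->] := shift_raise m.+1 iN R.
by apply/raise_diagramP; exists b'.
Qed.

(* Bubble sort from [e - d] to [d - 1]: the smallest column of the block
   [1, .., e] has reached position [c]. *)
Definition stage (e c d : nat) : nat :=
  if d < c then e - d.+1 else if d == c then e.-1 else if d <= e then e - d else d.-1.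

Definition labelable (n : nat) (a : n.-tuple nat) (g : nat -> nat) (D : diagram) : Prop :=
  exists2 rho, labeling a g rho & fills a g rho D.

Lemma labelable_ext n (a : n.-tuple nat) g g' D :
  (forall d, 0 < d -> g d = g' d) -> labelable a g D -> labelable a g' D.
Proof.
move=> e; have oE : occ a g = occ a g'.
  by apply: funext => i; apply: funext => -[|d]; rewrite /occ // e.
by case=> rho; rewrite /labeling /fills oE => L F; exists rho.
Qed.

Lemma tnth_le_max n (a : n.-tuple nat) i : tnth a i <= max_part a.
Proof. exact: (leq_bigmax i). Qed.

Lemma shift_labelable n (a : n.-tuple nat) e c D : 0 < c < e ->
  labelable a (stage e c) D ->
  labelable a (stage e c.+1) (shift n c D) /\ slack n D c 0 = 0.
Proof.
move=> /andP[c0 ce] [rho0 L0 F0].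
have sc : sortable (stage e c) c.
  split=> //; rewrite /stage; first by do ?case: ifP; lia.
  (* The columns beyond [e] are already those of a key tableau. *)
  by exists e; split=> d h; do ?case: ifP; lia.
have hB (i : 'I_n) d : occ a (stage e c) i d -> d <= maxn e (max_part a).
  have := tnth_le_max a i; rewrite /occ /stage; do ?case: ifP; lia.
have [rho [L F] T] := tight_labeling hB sc L0 F0.
split; last exact: slack0 sc L F T.
apply: labelable_ext (ex_intro2 _ _ _ (labeling_sorted sc L T) (fills_sorted sc L F T)).
move=> d d0; rewrite /stage; do ?case: ifP; lia.
Qed.

Lemma sweep_labelable n (a : n.-tuple nat) e m D : m < e ->
  labelable a (stage e 1) D -> labelable a (stage e m.+1) (sweep n m D).
Proof.
move=> me LD; elim: m me => //= m IH me.
by have [] := shift_labelable (c := m.+1) me (IH (ltnW me)).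
Qed.

(** After a full sweep the least filled column of the block is in its final place, and a block
    shorter by one remains. *)
Lemma stage_wrap e d : 0 < d -> stage e.+1 e.+1 d = stage e 1 d.
Proof. by move=> d0; rewrite /stage; do ?case: ifP; lia. Qed.

Lemma rect_labelable n (a : n.-tuple nat) e D :
  labelable a (stage e 1) D -> labelable a predn (rect n e D).
Proof.
elim: e D => [|e IH] D LD /=.
  by apply: labelable_ext LD => d d0; rewrite /stage; do ?case: ifP; lia.
apply: IH; apply: labelable_ext (sweep_labelable (ltnSn e) LD).
exact: stage_wrap.
Qed.

Lemma rect_inj n (a : n.-tuple nat) e D D' :
  labelable a (stage e 1) D -> labelable a (stage e 1) D' ->
  rect n e D = rect n e D' -> D = D'.
Proof.
elim: e D D' => //= e IH D D' LD LD' h.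
have {h} : sweep n e D = sweep n e D'.
  by apply: IH h; apply: labelable_ext (sweep_labelable (ltnSn e) _) => //; apply: stage_wrap.
have : e < e.+1 by [].
move: {1 3 4}e => m; elim: m => //= m IHm me h; apply: IHm; first exact: ltnW.
have [_ s] := shift_labelable (c := m.+1) me (sweep_labelable (ltnW me) LD).
have [_ s'] := shift_labelable (c := m.+1) me (sweep_labelable (ltnW me) LD').
exact: shift_inj s s' h.
Qed.

(** * Labelings and tableaux *)

(** This is K4. *)
Definition inversions_blocked (n : nat) (a : n.-tuple nat) (rho : 'I_n -> nat -> nat) :=
  forall i j : 'I_n, forall c, i < j -> occ a predn i c -> occ a predn j c ->
    rho j c < rho i c -> occ a predn i c.+1 /\ rho j c < rho i c.+1.

Lemma exchange_key n (a : n.-tuple nat) rho (i j : 'I_n) c :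
  labeling a predn rho -> i < j -> occ a predn i c -> occ a predn j c ->
  rho j c < rho i c -> (occ a predn i c.+1 -> rho i c.+1 <= rho j c) ->
  exists2 u, u <= c & exchangeable a predn rho i j u c.
Proof.
move=> [L1 L2 L3] ij oi oj lt nxt.
have sub (k : 'I_n) d d' : occ a predn k d' -> 0 < d <= d' -> occ a predn k d.
  by rewrite /occ; lia.
have c0 : 0 < c by case/andP: oi.
(* The exchange extends to the left of [c] as long as [i] is above [j]; column 0 counts as bad so
   that a last bad column exists. *)
pose bad d := (d <= c) && ((d == 0) || ~~ (rho j d < rho i d)).
have bc d : bad d -> d <= c by case/andP.
have [|m /andP[mc bm] max] := @ex_maxnP bad c _ bc; first by exists 0.
have mc' : m < c.
  rewrite ltn_neqAle mc andbT; apply: contraTneq bm => ->.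
  by rewrite lt; lia.
have good d : m < d <= c -> [/\ occ a predn i d, occ a predn j d & rho j d < rho i d].
  move=> /andP[md dc]; have d0 : 0 < d by lia.
  split; try by [apply: sub oi _; rewrite d0|apply: sub oj _; rewrite d0].
  apply: contraLR md => nd; rewrite -leqNgt; apply: max.
  by rewrite /bad dc nd orbT.
exists m.+1 => //; split.
- move=> d /good[oid ojd ->]; rewrite oid ojd /=.
  by have /andP[_ h] := L1 i d oid; apply: leq_trans h _; apply: ltnW.
- move=> d d' dm d'm ojd; have d0 : 0 < d by case/andP: ojd.
  have m0 : m == 0 = false by lia.
  rewrite m0 /= -leqNgt in bm.
  have oim : occ a predn i m by apply: sub oi _; lia.
  have ojm : occ a predn j m by apply: sub oj _; lia.
  have [oid' _ _] := good d' d'm.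
  have h : rho i d' <= rho j m by apply: leq_trans bm; apply: L3 oim oid'; lia.
  apply: (leq_trans h); have [->//|dm'] : d = m \/ d < m by lia.
  exact: L3 ojd ojm.
move=> d d' dc cd' oid'; have oic : occ a predn i c.+1 by apply: sub oid' _.
have [_ ojd _] := good d dc.
have h : rho i d' <= rho j c.
  apply: leq_trans (nxt oic); have [->//|lt'] : d' = c.+1 \/ c.+1 < d' by lia.
  exact: L3 oic oid'.
apply: (leq_trans h); have [->//|lt'] : d = c \/ d < c by lia.
exact: L3 ojd oj.
Qed.

(** An exchange at a violation of K4 gives the higher rows to the larger label, and so increases the
    sum of [k] times the row of [k]. *)
Lemma key_labeling n (a : n.-tuple nat) D : labelable a predn D ->
  exists2 rho, labeling a predn rho /\ fills a predn rho D & inversions_blocked a rho.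
Proof.
case=> rho L F; pose w (k : 'I_n) d := occ a predn k d * k.
pose B := (max_part a).+1.
apply: (@climb _ (fun rho => labeling a predn rho /\ fills a predn rho D) _
  (potential B w) (\sum_(d < B) \sum_(k < n) w k d * n)) (conj L F).
  move=> {L F} rho [[L1 _ _] F]; apply: potential_le => k d.
  rewrite /w; case: (boolP (occ a predn k d)) => // ok _.
  by have /andP[_ le] := L1 k d ok; apply: leq_trans le (ltn_ord k).
move=> {L F} rho [L F]; case: (pselect (exists i j : 'I_n, exists c,
  [/\ i < j, occ a predn i c, occ a predn j c, rho j c < rho i c &
      occ a predn i c.+1 -> rho i c.+1 <= rho j c])) =>
  [[i [j [c [ij oi oj lt nxt]]]]|no].
  have [u uc ex] := exchange_key L ij oi oj lt nxt.
  right; exists (swap_labels i j u c rho).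
    by split; [apply: labeling_swap | apply: fills_swap].
  apply: (@potential_swap _ _ _ _ _ _ _ _ c); rewrite ?uc ?leqnn //.
  - move=> d dv; case: ex => /(_ d dv)/and4P[o1 o2 -> _] _ _; split=> //.
    by rewrite /w o1 o2 !mul1n ltnW.
  - by move: oi; rewrite /occ /B => /andP[_ h]; have := tnth_le_max a i; lia.
  - by rewrite /w oi oj !mul1n.
left=> i j c ij oi oj lt; apply: contrapT => h; apply: no; exists i, j, c; split=> // oc.
by rewrite leqNgt; apply/negP => lt'; apply: h.
Qed.

Definition reads (n : nat) (a : n.-tuple nat) (g : nat -> nat)
    (rho : 'I_n -> nat -> nat) (T : ltableau) : Prop :=
  forall c r l, T.[? (c, r)] = Some l <->
    exists i : 'I_n, [/\ l = i.+1, occ a g i c & rho i c = r].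

Lemma reads_fills n (a : n.-tuple nat) g rho T :
  reads a g rho T -> fills a g rho (domf T).
Proof.
move=> R c r; rewrite -fndSome; split.
  case e : (T.[? (c, r)]) => [l|] // _.
  by have [i [_ oi ri]] := (R c r l).1 e; exists i.
by case=> i oi ri; rewrite (_ : T.[? (c, r)] = Some i.+1) //; apply/R; exists i.
Qed.

Lemma tableau_of_labeling n (a : n.-tuple nat) g rho D :
  labeling a g rho -> fills a g rho D ->
  exists2 T : ltableau, domf T = D & reads a g rho T.
Proof.
move=> [_ L2 _] F.
(* The default 0 never arises on [D], by [fills]. *)
pose lab (x : cell) := if [pick i | occ a g i x.1 && (rho i x.1 == x.2)] is Some i
  then (i : nat).+1 else 0.
pose T : ltableau := [fmap x : D => lab (val x)].
exists T => // c r l; split=> [|[i [-> oi ri]]].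
  case: fndP => // h [<-]; rewrite ffunE /= /lab /=; case: pickP => [i /andP[oi /eqP ri]|no].
    by exists i.
  by have [i oi ri] := (F c r).1 h; have := no i; rewrite oi ri eqxx.
have h : (c, r) \in domf T by apply/F; exists i.
rewrite (in_fnd h) ffunE /= /lab /=; case: pickP => [j /andP[oj /eqP rj]|/(_ i)].
  by rewrite (L2 j i c) // rj ri.
by rewrite oi ri eqxx.
Qed.

Lemma card_graph (f : nat -> nat) lo m :
  #|` [fset (c, f c) | c in [fset c in iota lo m]] | = m.
Proof.
rewrite card_imfset /=; last by move=> x y [].
by rewrite card_fseq undup_id ?iota_uniq // size_iota.
Qed.

(** It makes the number of columns in which a label occurs equal to its multiplicity. *)
Definition columns_interval (n : nat) (a : n.-tuple nat) (g : nat -> nat) :=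
  forall i : 'I_n, exists lo, forall c, occ a g i c = (c \in iota lo (tnth a i)).

Lemma reads_content n (a : n.-tuple nat) g rho T :
  columns_interval a g -> labeling a g rho -> reads a g rho T -> content a T.
Proof.
move=> ci [L1 _ _] R; split.
- move=> [c r] /(reads_fills R)[i oi <-]; rewrite /col /row /=.
  by have /andP[-> _] := L1 i c oi; case/andP: oi => ->.
- move=> [c r] l /R[i [-> _ _]]; exact: ltn_ord.
move=> i; have [lo H] := ci i.
rewrite -(card_graph (rho i) lo (tnth a i)); congr #|` _|.
apply/fsetP => -[c r]; rewrite !inE /=; apply/andP/imfsetP => [[_ /eqP/R[j [[e] oj rj]]]|].
  have {e} e : i = j by apply: val_inj.
  by subst j; exists c; rewrite ?inE -?H ?rj.
case=> d; rewrite !inE -H => oi [-> ->].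
have h : T.[? (d, rho i d)] = Some i.+1 by apply/R; exists i.
by rewrite h eqxx /Defs.shape -fndSome h.
Qed.

Lemma tableau_labeling n (a : n.-tuple nat) g T :
  columns_interval a g -> content a T ->
  (forall (i : 'I_n) c, occ a g i c -> once_in_column T i.+1 c) ->
  labels_ge_row T -> labels_weakly_descend T ->
  exists2 rho, labeling a g rho & reads a g rho T.
Proof.
move=> ci [C1 C2 C3] once ge desc.
have [f Hf] : {f : 'I_n * nat -> nat & forall x, occ a g x.1 x.2 ->
    T.[? (x.2, f x)] = Some x.1.+1}.
  apply: (@choice _ _ (fun x r => occ a g x.1 x.2 -> T.[? (x.2, r)] = Some x.1.+1)).
  move=> -[i c] /=; case: (boolP (occ a g i c)) => [/once[r [h _]]|_].
    by exists r.
  by exists 0.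
pose rho i c := f (i, c).
have Tr i c : occ a g i c -> T.[? (c, rho i c)] = Some i.+1 by apply: (Hf (i, c)).
have R : reads a g rho T.
  move=> c r l; split=> [h|[i [-> oi <-]]]; last exact: Tr.
  have /andP[l0 ln] := C2 _ _ h.
  have ln' : l.-1 < n by rewrite prednK.
  pose i := Ordinal ln'; have li : l = i.+1 by rewrite /= prednK.
  have [lo H] := ci i.
  pose S := [fset x in domf T | T.[? x] == Some i.+1].
  pose G := [fset (c, rho i c) | c in [fset c in iota lo (tnth a i)]].
  (* One cell in each prescribed column already exhausts the multiplicity, so the label has no other
     cell. *)
  have GS : G = S.
    apply/eqP; rewrite eqEfcard card_graph; apply/andP; split; last by rewrite -(C3 i).
    apply/fsubsetP => x /imfsetP[d /=]; rewrite !inE -H => od ->.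
    by rewrite -fndSome Tr //=.
  have : (c, r) \in S by rewrite !inE -fndSome h li /=.
  rewrite -GS => /imfsetP[d /=]; rewrite !inE -H => od [-> ->].
  by exists i.
exists rho => //; split.
- move=> i c oi; have h := Tr i c oi; rewrite (ge _ _ _ h) andbT.
  have /andP[] // : (0 < col (c, rho i c)) && (0 < row (c, rho i c)).
  by apply: C1; rewrite /Defs.shape -fndSome h.
- move=> i j c oi oj e; have := Tr i c oi; rewrite e Tr // => -[e'].
  by apply: val_inj.
- by move=> i c c' cc' oi oi'; apply: (desc i.+1) cc' (Tr _ _ oi) (Tr _ _ oi').
Qed.

Lemma key_interval n (a : n.-tuple nat) : columns_interval a predn.
Proof. by move=> i; exists 1 => -[|c]; rewrite /occ mem_iota. Qed.

Lemma lock_occ n (a : n.-tuple nat) (i : 'I_n) c :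
  occ a (stage (max_part a) 1) i c =
  (max_part a - tnth a i + 1 <= c <= max_part a).
Proof.
have := tnth_le_max a i; rewrite /occ /stage; do ?case: ifP; lia.
Qed.

Lemma lock_interval n (a : n.-tuple nat) :
  columns_interval a (stage (max_part a) 1).
Proof.
move=> i; exists (max_part a - tnth a i + 1) => c.
by rewrite lock_occ mem_iota; have := tnth_le_max a i; lia.
Qed.

Lemma LKT_labeling n (a : n.-tuple nat) T : LKT a T ->
  exists2 rho, labeling a (stage (max_part a) 1) rho &
               reads a (stage (max_part a) 1) rho T.
Proof.
case=> C once ge desc _; apply: tableau_labeling => //; first exact: lock_interval.
by move=> i c; rewrite lock_occ; apply: once.
Qed.

Lemma key_occ n (a : n.-tuple nat) (i : 'I_n) c :
  occ a predn i c = (1 <= c <= tnth a i).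
Proof. by case: c => [|c]; rewrite /occ. Qed.

Lemma KKT_labeling n (a : n.-tuple nat) T : KKT a T ->
  exists2 rho, labeling a predn rho & reads a predn rho T.
Proof.
case=> C once ge desc _; apply: tableau_labeling => //; first exact: key_interval.
by move=> i c; rewrite key_occ; apply: once.
Qed.

Lemma KKT_of_labeling n (a : n.-tuple nat) rho T :
  labeling a predn rho -> reads a predn rho T -> inversions_blocked a rho -> KKT a T.
Proof.
move=> L R K; have [L1 L2 L3] := L; split.
- exact: reads_content (key_interval a) L R.
- move=> i c; rewrite -key_occ => oi; exists (rho i c); split; first by apply/R; exists i.
  by move=> r /R[j [[e] _ <-]]; congr rho; apply: val_inj.
- by move=> c r l /R[i [-> oi <-]]; have /andP[] := L1 i c oi.
- move=> l c c' r r' cc' /R[i [-> oi <-]] /R[j [[e] oj <-]].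
  have {e} e : i = j by apply: val_inj.
  by subst j; apply: L3.
move=> l l' c r s ij sr /R[i [ei oi ri]] /R[j [ej oj rj]]; subst.
have [oi' lt] := K i j c ij oi oj sr.
by exists (rho i c.+1) => //; apply/R; exists i.
Qed.

(** * Uniqueness of labelings *)

Definition no_inversion_clash n (a : n.-tuple nat) g (rho rho' : 'I_n -> nat -> nat) c :=
  forall i j : 'I_n, i < j -> occ a g i c -> occ a g j c ->
    rho j c < rho i c -> rho' i c <> rho j c.

(** At the lowest row where the labelings disagree, each of the two labels found there lies higher
    in the other labeling. The smaller of the two then produces an excluded clash. *)
Lemma column_determined n (a : n.-tuple nat) g rho rho' D c :
  labeling a g rho -> labeling a g rho' -> fills a g rho D -> fills a g rho' D ->
  no_inversion_clash a g rho rho' c -> no_inversion_clash a g rho' rho c ->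
  forall j, occ a g j c -> rho j c = rho' j c.
Proof.
move=> [_ I _] [_ I' _] F F' H H'.
suff P : forall s (j : 'I_n), occ a g j c -> (rho j c = s <-> rho' j c = s).
  by move=> j oj; apply/esym/(P _ j oj).
elim/ltn_ind => s IH j oj.
have half f f' :
  (forall i j : 'I_n, occ a g i c -> occ a g j c -> f i c = f j c -> i = j) ->
  (forall i j : 'I_n, occ a g i c -> occ a g j c -> f' i c = f' j c -> i = j) ->
  fills a g f D -> fills a g f' D ->
  no_inversion_clash a g f f' c -> no_inversion_clash a g f' f c ->
  (forall m, m < s -> forall j, occ a g j c -> (f j c = m <-> f' j c = m)) ->
  forall j, occ a g j c -> f j c = s -> f' j c = s.
  move=> {I I' F F' H H' IH j oj} I I' F F' H H' IH j oj e.
  have /F'[i oi ei] : (c, s) \in D by apply/F; exists j.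
  have [<- //|/eqP ij] := eqVneq i j.
  have fi : s < f i c.
    rewrite ltn_neqAle; apply/andP; split.
      by apply/eqP => es; apply: ij; apply: I => //; rewrite -es.
    rewrite leqNgt; apply/negP => lt; have := (IH _ lt i oi).1 erefl; lia.
  have f'j : s < f' j c.
    rewrite ltn_neqAle; apply/andP; split.
      by apply/eqP => es; apply: ij; apply: I' => //; rewrite -es.
    rewrite leqNgt; apply/negP => lt; have := (IH _ lt j oj).2 erefl; lia.
  have [lt|lt|/val_inj//] := ltngtP i j.
    by case: (H i j lt oi oj); rewrite e.
  by case: (H' j i lt oj oi); rewrite ei.
have Ic i k := I i k c; have Ic' i k := I' i k c.
split; first exact: (half rho rho' Ic Ic' F F' H H' IH j oj).
apply: (half rho' rho Ic' Ic F' F H' H _ j oj) => m ms k ok.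
exact: iff_sym (IH m ms k ok).
Qed.

Lemma reads_determined n (a : n.-tuple nat) g rho rho' T T' :
  labeling a g rho -> labeling a g rho' -> reads a g rho T -> reads a g rho' T' ->
  domf T = domf T' ->
  (forall i j, occ a g i j -> rho i j = rho' i j) -> T = T'.
Proof.
move=> L L' R R' e H; apply/fmapP => -[c r].
have E l : T.[? (c, r)] = Some l <-> T'.[? (c, r)] = Some l.
  by rewrite R R'; split=> -[i [-> oi <-]]; exists i; rewrite H.
case h : (T.[? (c, r)]) => [l|]; first by apply/esym/E.
by case h' : (T'.[? (c, r)]) => [l|] //; move/E: h'; rewrite h.
Qed.

(** Strict columns have no inversions, so no clash arises. *)
Lemma LKT_shape_inj n (a : n.-tuple nat) T T' : LKT a T -> LKT a T' ->
  domf T = domf T' -> T = T'.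
Proof.
move=> K K' e; have [rho L R] := LKT_labeling K; have [rho' L' R'] := LKT_labeling K'.
have F := reads_fills R; have F' := reads_fills R'; rewrite -e in F'.
have nc f1 (T1 : ltableau) f2 c : LKT a T1 -> reads a (stage (max_part a) 1) f1 T1 ->
    no_inversion_clash a (stage (max_part a) 1) f1 f2 c.
  move=> [_ _ _ _ str] R1 i j ij oi oj lt _.
  have : j.+1 < i.+1.
    by apply: (str i.+1 j.+1 c _ _ lt); apply/R1; [exists i | exists j].
  lia.
apply: (reads_determined L L' R R' e) => i c oi.
by apply: (column_determined L L' F F') oi; [exact: nc K R | exact: nc K' R'].
Qed.

(** The columns are treated from right to left. For an inversion, K4 puts [i] in column [c.+1] above
    the row of [j]; the labelings agree in that column, so by K3 the other one cannot have [i] in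
    the cell of [j]. *)
Lemma KKT_shape_inj n (a : n.-tuple nat) T T' : KKT a T -> KKT a T' ->
  domf T = domf T' -> T = T'.
Proof.
move=> K K' e; have [rho L R] := KKT_labeling K; have [rho' L' R'] := KKT_labeling K'.
have F := reads_fills R; have F' := reads_fills R'; rewrite -e in F'.
have nc f1 (T1 : ltableau) f2 c : KKT a T1 -> reads a predn f1 T1 -> labeling a predn f2 ->
    (forall i : 'I_n, occ a predn i c.+1 -> f1 i c.+1 = f2 i c.+1) ->
    no_inversion_clash a predn f1 f2 c.
  move=> [_ _ _ _ inv] R1 [_ _ L3] same i j ij oi oj lt e'.
  have [t st /R1[k [[ek] ok rk]]] : exists2 t, f1 j c < t & T1.[? (c.+1, t)] = Some i.+1.
    by apply: (inv i.+1 j.+1 c (f1 i c)) => //; apply/R1; [exists i | exists j].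
  have {ek} ek : i = k by apply: val_inj.
  subst k; have := L3 i c c.+1 (ltnSn c) oi ok; rewrite -same //; lia.
apply: (reads_determined L L' R R' e) => i c.
have [m] := ubnP (max_part a - c); elim: m i c => // m IH i c le oi.
have same (k : 'I_n) : occ a predn k c.+1 -> rho k c.+1 = rho' k c.+1.
  move=> ok; apply: IH => //; move: ok; rewrite key_occ; have := tnth_le_max a k; lia.
apply: (column_determined L L' F F') oi.
  exact: nc K R L' same.
by apply: nc K' R' L _ => // k ok; rewrite same.
Qed.

(** * The operators on tableaux and the map Phi *)

Lemma choose_inP (U : Type) (A : set U) x : choose_in A = Some x -> A x.
Proof. by rewrite /choose_in; case: pselect => // h [<-]; case: cid. Qed.

Lemma choose_in_unique (U : Type) (A : set U) x :
  A x -> (forall y, A y -> y = x) -> choose_in A = Some x.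
Proof.
move=> Ax uniq; rewrite /choose_in; case: pselect => [h|[]]; last by exists x.
by case: cid => y Ay /=; rewrite (uniq y Ay).
Qed.

Lemma raise_Some (X : set ltableau) i T T' : raise X i T = Some T' ->
  X T' /\ raise_diagram i (domf T) = Some (domf T').
Proof. exact: choose_inP. Qed.

Lemma lower_Some (X : set ltableau) i T T' : lower X i T = Some T' ->
  X T' /\ raise X i T' = Some T.
Proof. exact: choose_inP. Qed.

Lemma LKT_labelable n (a : n.-tuple nat) T : LKT a T ->
  labelable a (stage (max_part a) 1) (domf T).
Proof. by move=> /LKT_labeling[rho L R]; exists rho => //; apply: reads_fills. Qed.

Lemma key_rectification n (a : n.-tuple nat) T : LKT a T ->
  exists2 T', KKT a T' & domf T' = rect n (max_part a) (domf T).
Proof.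
move=> /LKT_labelable/rect_labelable/key_labeling[rho [L F] K].
have [T' sh R] := tableau_of_labeling L F.
by exists T' => //; apply: KKT_of_labeling L R K.
Qed.

Theorem theorem5p1 (n : nat) (a : n.-tuple nat) :
  exists Phi : ltableau -> ltableau,
    [/\ set_fun (LKT a) (KKT a) Phi,
        set_inj (LKT a) Phi,
        forall T, LKT a T -> wt (Phi T) =1 wt T
      & forall T i, LKT a T -> 1 <= i < n ->
          (forall T', raise (LKT a) i T = Some T' ->
             raise (KKT a) i (Phi T) = Some (Phi T'))
          /\ (forall T', lower (LKT a) i T = Some T' ->
             lower (KKT a) i (Phi T) = Some (Phi T'))].
Proof.
have [Phi PhiP] : {Phi : ltableau -> ltableau & forall T, LKT a T ->
    KKT a (Phi T) /\ domf (Phi T) = rect n (max_part a) (domf T)}.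
  apply: (@choice _ _ (fun T T' => LKT a T ->
    KKT a T' /\ domf T' = rect n (max_part a) (domf T))) => T.
  case: (pselect (LKT a T)) => [/key_rectification[T' K e]|nT].
    by exists T'.
  by exists T.
have raiseP T T' i : LKT a T -> LKT a T' -> 1 <= i < n ->
    raise_diagram i (domf T) = Some (domf T') ->
    raise (KKT a) i (Phi T) = Some (Phi T').
  move=> K K' /andP[_ iN] h.
  have [KT eT] := PhiP T K; have [KT' eT'] := PhiP T' K'.
  have h' : raise_diagram i (domf (Phi T)) = Some (domf (Phi T')).
    by rewrite eT eT'; apply: rect_raise.
  apply: choose_in_unique => // T'' [KT'']; rewrite /Defs.shape h' => -[e].
  by apply: (KKT_shape_inj KT'' KT'); rewrite e.
exists Phi; split.
- by move=> T /PhiP[].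
- move=> T T' /[!inE] K K' e; apply: (LKT_shape_inj K K').
  apply: (rect_inj (LKT_labelable K) (LKT_labelable K')).
  by have [_ <-] := PhiP T K; have [_ <-] := PhiP T' K'; rewrite e.
- by move=> T /PhiP[_ e] r; rewrite /wt /Defs.shape e wt_rect.
move=> T i K iN; split=> T'.
  by move=> /raise_Some[K' h]; apply: raiseP.
move=> /lower_Some[K' /raise_Some[_ h]].
(* The lowering of [T] is a [T'] that raises to [T], so the raising case applies to [T'];
   injectivity of the raising gives uniqueness. *)
have R := raiseP _ _ _ K' K iN h.
have [KT' _] := PhiP T' K'; have [_ e] := raise_Some R.
apply: choose_in_unique => // T'' [KT'' /raise_Some[_ e'']].
by apply: (KKT_shape_inj KT'' KT'); apply: raise_diagram_inj e'' e.
Qed.
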